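(* Let $n\ge 1$ and let $A=(A_i)_{i\in\mathbb{Z}}$ be a (generic) twisted $n$-gon indexed by $\mathbb{Z}$, and put $y_j=y_j(A)$ for $j\in\mathbb{Z}$. Then for every integer $k\ge 1$ and every $j\in\mathbb{Z}$, $$y_j(T^k(A))=\begin{cases}\left(\prod_{i=-k}^{k}y_{j+3i}\right)\dfrac{F_{j-1,k}F_{j+1,k}}{F_{j-3,k}F_{j+3,k}}, & j+k\text{ even},\\[2mm] \left(\prod_{i=-k+1}^{k-1}y_{j+3i}\right)^{-1}\dfrac{F_{j-3,k-1}F_{j+3,k-1}}{F_{j-1,k-1}F_{j+1,k-1}}, & j+k\text{ odd},\end{cases}$$ where for $m\ge 0$ $$F_{j,m}=\sum_{I\in J(P_m)}\ \prod_{(r,s,t)\in I}y_{3r+s+j}.$$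
   Context: A twisted $n$-gon is a sequence $A=(A_i)$ of points of the real projective plane, indexed either by $\mathbb{Z}$ or by $\frac12+\mathbb{Z}$, such that $A_{i+n}=\phi(A_i)$ for all $i$, for some projective transformation $\phi$. The pentagram map $T$ sends a (generic) twisted polygon $A$ to the twisted polygon $B=T(A)$ indexed by the other coset ($\frac12+\mathbb{Z}$ if $A$ is indexed by $\mathbb{Z}$ and vice versa) given by $B_i=\overleftrightarrow{A_{i-3/2}A_{i+1/2}}\cap\overleftrightarrow{A_{i-1/2}A_{i+3/2}}$, where $\overleftrightarrow{PQ}$ is the line through $P,Q$. The cross ratio is $\chi(a,b,c,d)=\frac{(a-b)(c-d)}{(a-c)(b-d)}$, extended projectively to four points on a projective line, or dually to four concurrent lines. For a twisted polygon $A$ and each index $k$ of $A$ (so $2k\in\mathbb{Z}$), the $y$-parameters are $y_{2k}(A)=-\big(\chi(\overleftrightarrow{A_kA_{k-2}},\overleftrightarrow{A_kA_{k-1}},\overleftrightarrow{A_kA_{k+1}},\overleftrightarrow{A_kA_{k+2}})\big)^{-1}$ and $y_{2k+1}(A)=-\chi(\overleftrightarrow{A_{k-2}A_{k-1}}\cap L,\,A_k,\,A_{k+1},\,\overleftrightarrow{A_{k+2}A_{k+3}}\cap L)$ with $L=\overleftrightarrow{A_kA_{k+1}}$; this defines $y_j(A)$ for all $j\in\mathbb{Z}$. Genericity means all constructions involved are defined and all quantities finite and nonzero. For an integer $k$, $Q_k$ is the set of $(r,s,t)\in\mathbb{Z}^3$ with $2|s|-(k-2)\le t\le k-2-2|r|$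 and $2|s|-(k-2)\equiv t\equiv k-2-2|r|\pmod 4$. $P_k=Q_{k+1}\cup Q_k$, partially ordered by the order generated by the covering relation: $(r',s',t')$ covers $(r,s,t)$ iff $t'=t+1$ and $|r'-r|+|s'-s|=1$. $J(P_k)$ is the set of order ideals (down-closed subsets, including $\emptyset$) of $P_k$. *)

(* Defs.v *)
From mathcomp Require Import all_boot all_order all_algebra.
From mathcomp Require Import finmap reals zify.

Set Implicit Arguments.
Unset Strict Implicit.
Unset Printing Implicit Defensive.

Import Order.TTheory GRing.Theory Num.Theory.
Local Open Scope ring_scope.

(* A point (resp. a line) of the real projective plane is a subspace of R^3 of
   dimension 1 (resp. 2), so that projective equality is Leibniz equality. The
   line through two distinct points is their sum (P + Q)%VS, and the point of
   intersection of two distinct lines is their intersection (L :&: M)%VS. *)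
Notation subspace R := {vspace 'rV[R]_3}.

Section Plane.
Variable R : realType.
Implicit Types (L P U : subspace R).

(* Homogeneous coordinates (x_0 : x_1) on the line L, with respect to the
   basis of L chosen by the library; the cross ratio does not depend on it. *)
Definition frame L : 2.-tuple 'rV[R]_3 := [tuple (vbasis L)`_0; (vbasis L)`_1].

Definition hcoord L P (i : 'I_2) : R := coord (frame L) i (vpick P).

(* In the affine chart (x : 1) this is the difference of the coordinates. *)
Definition bracket L P P' : R :=
  hcoord L P 0 * hcoord L P' 1 - hcoord L P 1 * hcoord L P' 0.

Definition cross_ratio L (a b c d : subspace R) : R :=
  (bracket L a b * bracket L c d) / (bracket L a c * bracket L b d).

(* Projective duality: U |-> {v | v . u = 0 for all u in U} exchanges points
   and lines, and turns the pencil of lines through P into a line. *)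
Definition dual U : subspace R :=
  (\bigcap_(u <- vbasis U) lker (linfun (mulmxr (u^T : 'cV[R]_3))))%VS.

Definition pencil_cross_ratio P (a b c d : subspace R) : R :=
  cross_ratio (dual P) (dual a) (dual b) (dual c) (dual d).

(* (a - b)(c - d) / ((a - c)(b - d)) is defined, finite and nonzero. *)
Definition cross_ratio_generic (a b c d : subspace R) : Prop :=
  [/\ a != b, c != d, a != c & b != d].

End Plane.

(* halfint A = false: A is indexed by Z, and vertex A m is A_m;
   halfint A = true: A is indexed by 1/2 + Z, and vertex A m is A_(m + 1/2). *)
Record polygon (R : realType) := Polygon {
  halfint : bool;
  vertex : int -> subspace R
}.

Section Polygon.
Variable R : realType.
Implicit Types (A : polygon R) (p j : int).

(* An index i is represented from now on by the integer p = 2i: pt A p is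
   A_(p/2), which makes sense when p has the parity of halfint A. *)
Definition is_index A p : bool := (2 %| p - (halfint A)%:Z)%Z.

Definition pt A p : subspace R := vertex A ((p - (halfint A)%:Z) %/ 2)%Z.

(* With k = p/2, the line through A_k and A_(k+i). *)
Definition chord A p (i : int) : subspace R := (pt A p + pt A (p + 2 * i))%VS.

Definition twisted (n : nat) A : Prop :=
  (forall m, \dim (vertex A m) = 1%N) /\
  exists2 phi : 'End('rV[R]_3), lker phi = 0%VS &
    forall m : int, vertex A (m + n%:Z) = (phi @: vertex A m)%VS.

Definition pentagram A : polygon R :=
  Polygon (~~ halfint A) (fun m => let p := 2 * m + (~~ halfint A)%:Z in
    (chord A (p - 3) 2 :&: chord A (p - 1) 2)%VS).

(* For an index k = p/2 of A, the points of A_k A_(k+1) that define y_(2k+1). *)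
Definition side_left A p : subspace R := (chord A (p - 4) 1 :&: chord A p 1)%VS.

Definition side_right A p : subspace R := (chord A (p + 4) 1 :&: chord A p 1)%VS.

Definition yparam A j : R :=
  if is_index A j then
    - (pencil_cross_ratio (pt A j)
         (chord A j (- 2)) (chord A j (- 1)) (chord A j 1) (chord A j 2))^-1
  else let p := j - 1 in
    - cross_ratio (chord A p 1)
        (side_left A p) (pt A p) (pt A (p + 2)) (side_right A p).

(* All the lines and intersection points that occur in pentagram A and in the
   y-parameters of A are defined, and the y-parameters are finite and nonzero. *)
Definition generic A : Prop := forall p, is_index A p ->
  [/\ pt A p != pt A (p + 2) /\ pt A p != pt A (p + 4),
      chord A p 2 != chord A (p + 2) 2,
      chord A (p - 4) 1 != chord A p 1 /\ chord A (p + 4) 1 != chord A p 1,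
      cross_ratio_generic
        (chord A p (- 2)) (chord A p (- 1)) (chord A p 1) (chord A p 2) &
      cross_ratio_generic
        (side_left A p) (pt A p) (pt A (p + 2)) (side_right A p)].

End Polygon.

Definition zrange (n : nat) : seq int := [seq i%:Z - n%:Z | i <- iota 0 n.*2.+1].

Lemma mem_zrange n (i : int) : (i \in zrange n) = (`|i| <= n)%N.
Proof.
apply/mapP/idP => [[m]|le_in]; first by rewrite mem_iota => ? ->; lia.
by exists (absz (i + n%:Z)); [rewrite mem_iota; lia | lia].
Qed.

Definition triple : choiceType := (int * int * int)%type.

Definition Qpred (k : int) (x : triple) : bool :=
  let: (r, s, t) := x in
  [&& 2 * `|s| - (k - 2) <= t, t <= k - 2 - 2 * `|r|,
      (2 * `|s| - (k - 2) == t %[mod 4])%Z & (t == k - 2 - 2 * `|r| %[mod 4])%Z].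

Definition box (m : nat) : seq triple :=
  [seq (rs, t) | rs <- [seq (r, s) | r <- zrange m, s <- zrange m],
                 t <- zrange m].

(* The box only serves to make P_m manifestly finite, see in_Pset. *)
Definition Pset (m : nat) : {fset triple} :=
  [fset x in box m | Qpred (m%:Z + 1) x || Qpred m%:Z x]%fset.

Lemma in_Pset m x : (x \in Pset m) = Qpred (m%:Z + 1) x || Qpred m%:Z x.
Proof.
rewrite in_fset; apply: andb_idl; case: x => [[r s] t] Qx.
have /and3P[r_m s_m t_m] : [&& `|r| <= m, `|s| <= m & `|t| <= m]%N.
  by case/orP: Qx => /and4P[? ? _ _]; apply/and3P; split; lia.
have rs_m : (r, s) \in [seq (r, s) | r <- zrange m, s <- zrange m].
  by apply: allpairs_f; rewrite mem_zrange.
by apply: (allpairs_f pair rs_m); rewrite mem_zrange.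
Qed.

Definition covers (x' x : triple) : bool :=
  let: (r', s', t') := x' in let: (r, s, t) := x in
  (t' == t + 1) && (`|r' - r| + `|s' - s| == 1).

Definition Ple m : rel (Pset m) := connect (fun x x' => covers (val x') (val x)).

Definition order_ideal m (I : {set Pset m}) : bool :=
  [forall x in I, forall z, Ple z x ==> (z \in I)].

Definition Fpoly (R : realType) (y : int -> R) (j : int) (m : nat) : R :=
  \sum_(I : {set Pset m} | order_ideal I)
    \prod_(x in I) (let: (r, s, t) := val x in y (3 * r + s + j)).

(* Main.v *)
(** The pentagram map acts on the y-parameters by an explicit rational
    substitution [y |-> y'] (a Y-pattern mutation).  Writing all y-parameters as
    monomials in the 3x3 determinants [A_p, A_q, A_r], with the vertices of
    [T A] given by cross products, this becomes an identity between monomials;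
    the factors [1 + y_j] become monomials by a Pluecker relation.

    Under the same substitution the polynomials satisfy
    [F_{j,k+1}(y) = prod_i (1 + y_{j+3i}) F_{j,k}(y')], [i] ranging over
    [-k, -k+2, ..., k].  This is domino shuffling: an order ideal of
    [P_{k+1} = Q_{k+2} U Q_{k+1}] is determined by its trace [D] on [Q_{k+1}]
    and by independent choices at the elements of [Q_{k+2}], an ideal of
    [P_k = Q_{k+1} U Q_k] by [D] and independent choices on [Q_k], and the two
    contributions of a given [D] agree up to the stated factor.  The theorem
    follows by induction on [k], replacing [A] by [T A]. *)

Require Import Defs.
From mathcomp Require Import all_boot all_order all_algebra.
From mathcomp Require Import finmap reals zify ring lra.

Set Implicit Arguments.
Unset Strict Implicit.
Unset Printing Implicit Defensive.

Import Order.TTheory GRing.Theory Num.Theory.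
Local Open Scope ring_scope.

(** * Order ideals of the posets P_m *)

Definition weight (R : realType) (y : int -> R) (j : int) (x : triple) : R :=
  let: (r, s, t) := x in y (3 * r + s + j).

(** One ambient finite type for all the posets: ideals of P_{k+1} and of P_k are compared through a
    common trace, so both are viewed as subsets of the same cube. *)
Definition cube (N : nat) : {fset triple} := [fset x in box N]%fset.

Lemma mem_cube N r s t :
  (((r, s, t) : triple) \in cube N) = [&& `|r| <= N, `|s| <= N & `|t| <= N]%N.
Proof.
have -> : (((r, s, t) : triple) \in cube N) = ((r, s, t) \in box N) by rewrite in_fset.
apply/allpairsP/and3P => [[[[r1 s1] t1] [/allpairsP[[r2 s2] [r_N s_N [e1 e2]]] t_N]]|].
  by case=> -> -> ->; rewrite e1 e2 -!mem_zrange.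
case=> r_N s_N t_N; exists ((r, s), t).
have rs_N : (r, s) \in [seq (r, s) | r <- zrange N, s <- zrange N].
  by apply: allpairs_f; rewrite mem_zrange.
by split; [exact: rs_N | rewrite mem_zrange | ].
Qed.

Lemma order_idealP m (I : {set Pset m}) :
  reflect (forall x z : Pset m, x \in I -> covers (val x) (val z) -> z \in I)
          (order_ideal I).
Proof.
apply: (iffP forall_inP) => [idI x z xI xz|clI x xI].
  by move/forallP/(_ z)/implyP: (idI x xI); apply; apply: connect1.
apply/forallP => z; apply/implyP => /connectP[p]; elim: p z => [|a p IHp] z /=.
  by move=> _ <-.
by case/andP=> za /IHp{}IHp /IHp aI; apply: clI za.
Qed.

(** Closure along covers suffices, since the order is their reflexive transitive closure. *)
Definition ideal_in (P : pred triple) N (I : {set cube N}) : bool :=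
  [forall x in I, P (val x) &&
     [forall z : cube N, P (val z) && covers (val x) (val z) ==> (z \in I)]].

Lemma Fpoly_cube (R : realType) (y : int -> R) j m N : (m <= N)%N ->
  Fpoly y j m =
  \sum_(I : {set cube N} | ideal_in (mem (Pset m)) I)
     \prod_(x in I) weight y j (val x).
Proof.
move=> le_mN.
have sub x : x \in Pset m -> x \in cube N.
  rewrite in_fset => /andP[xm _].
  have: x \in cube m by rewrite in_fset.
  by case: x {xm} => [[r s] t]; rewrite !mem_cube; lia.
pose f (x : Pset m) : cube N := [` sub (val x) (valP x)]%fset.
have fE x : val (f x) = val x by [].
have f_inj : injective f by move=> a b /(congr1 val); rewrite !fE => /val_inj.
(* Ideals of [Pset m] and of the cube correspond under image and preimage by the inclusion [f]. *)
rewrite /Fpoly (reindex_onto (fun I : {set cube N} => f @^-1: I) (fun I => f @: I)); last first.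
  by move=> I _; apply/setP => x; rewrite inE mem_imset.
apply: eq_big => [I|I /andP[_ /eqP imI]].
  apply/andP/forall_inP => [[/order_idealP idI /eqP imI] x xI|idI].
    have [x' x'I ->] : exists2 x', f x' \in I & x = f x'.
      by rewrite -imI in xI; case/imsetP: xI => x'; rewrite inE => ? ->; exists x'.
    rewrite /= (valP x') /=; apply/forallP => z; apply/implyP => /andP[zP xz].
    have -> : z = f [` zP]%fset by apply: val_inj.
    by have := idI x' [` zP]%fset; rewrite !inE; apply.
  split.
    apply/order_idealP => x z; rewrite !inE => xI xz.
    have /andP[_ /forallP/(_ (f z))/implyP] := idI _ xI; apply.
    by rewrite xz andbT fE; apply: (valP z).
  apply/eqP/setP => x; apply/imsetP/idP => [[x']|xI]; first by rewrite inE => ? ->.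
  have /andP[xP _] := idI _ xI.
  by exists [` xP]%fset; [rewrite inE; congr (_ \in I): (xI); apply: val_inj | apply: val_inj].
rewrite -{2}imI big_imset //=; last by move=> ? ? _ _ /f_inj.
Qed.

(* When all covers go between the two classes [E] and [X], the ideals with given
   trace [D] on [X] are obtained by deciding independently, for each [e] in
   [E], whether to include it: some [e] are forced in by an element of [D] above
   them, others are not allowed because of a missing element below. *)
Section Bipartite.
Variables (R : comNzRingType) (w : triple -> R) (N : nat) (E X : pred triple).
Hypothesis EX : forall x, E x -> ~~ X x.
Hypothesis covE : forall x z, covers x z -> E x -> ~~ E z.
Hypothesis covX : forall x z, covers x z -> X x -> ~~ X z.
Implicit Types (D I : {set cube N}) (x z e : cube N).

Definition forced D e := [exists x in D, covers (val x) (val e)].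

Definition allowed D e :=
  [forall x : cube N, X (val x) && covers (val e) (val x) ==> (x \in D)].

Let layer : {set cube N} := [set x | X (val x)].

(** The ideal condition for a given trace [D], split into one condition per point so that the sum
    over [I] can factor. *)
Definition compatible D I x :=
  if x \in I then (if E (val x) then allowed D x else x \in D)
  else (if E (val x) then ~~ forced D x else x \notin D).

(** A cover inside the union joins a point of [E] to a point of [X], whose status is dictated by
    [D]; so no two points of [E] constrain each other. *)
Lemma ideal_in_compatible D I : D \subset layer ->
  ideal_in (predU E X) I && (I :&: layer == D) = [forall x, compatible D I x].
Proof.
move=> /subsetP DX; have {}DX x : x \in D -> X (val x) by move/DX; rewrite inE.
apply/andP/forallP => [[/forall_inP idI /eqP ID] x|ok].
  have subD z : z \in D -> z \in I by rewrite -ID inE => /andP[].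
  rewrite /compatible; case: ifP => xI; case: ifP => xE.
  - apply/forallP => z; apply/implyP => /andP[zX xz].
    have /andP[_ /forallP/(_ z)] := idI x xI.
    by rewrite /= zX orbT xz /= -ID !inE zX andbT.
  - have /andP[/= + _] := idI x xI.
    by rewrite xE /= -ID !inE xI.
  - apply/negP => /exists_inP[z /subD zI zx].
    have /andP[_ /forallP/(_ x)] := idI z zI.
    by rewrite /= xE zx /= xI.
  - by apply/negP => /subD; rewrite xI.
have DI x : x \in D -> x \in I.
  move=> xD; move: (ok x); rewrite /compatible xD; case: ifP => // _.
  by case: ifP => // /EX; rewrite DX.
split; last first.
  apply/eqP/setP => x; rewrite !inE; apply/andP/idP => [[xI xX]|xD]; last first.
    by split; [apply: DI | apply: DX].
  by move: (ok x); rewrite /compatible xI; case: ifP => // /EX; rewrite xX.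
apply/forall_inP => x xI; move: (ok x); rewrite /compatible xI => okx.
apply/andP; split; first by move: okx => /=; case: ifP => //= _ /DX.
apply/forallP => z; apply/implyP => /andP[zP xz].
move: okx; case: ifP => xE okx.
  apply: DI; move/forallP/(_ z)/implyP: okx; apply.
  by move: zP => /=; rewrite xz (negbTE (covE xz xE)) /= => ->.
move: zP => /=; rewrite (negbTE (covX xz (DX _ okx))) orbF => zE.
apply/negPn/negP => zI; move: (ok z); rewrite /compatible (negbTE zI) zE.
by apply/negP/negPn/exists_inP; exists x.
Qed.

Lemma sum_ideal_bipartite :
  \sum_(I : {set cube N} | ideal_in (predU E X) I) \prod_(x in I) w (val x) =
  \sum_(D : {set cube N} | D \subset layer)
     (\prod_(x in D) w (val x)) *
     \prod_(e : cube N | E (val e))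
        ((if allowed D e then w (val e) else 0) + (if forced D e then 0 else 1)).
Proof.
rewrite (partition_big (fun I : {set cube N} => I :&: layer) (fun D => D \subset layer)) /=;
  last by move=> I _; apply: subsetIr.
apply: eq_bigr => D DX; under eq_bigl => I do rewrite ideal_in_compatible //.
(* [G1] and [G0] are the contributions of a point inside and outside [I], set to 0 when incompatible
   with [D]. Expanding the product of the sums [G1 + G0] gives a sum over all subsets [I]. *)
pose G1 e := if E (val e) then (if allowed D e then w (val e) else 0)
             else (if e \in D then w (val e) else 0).
pose G0 e := if E (val e) then (if forced D e then 0 else 1 : R)
             else (if e \in D then 0 else 1).
transitivity (\prod_e (G1 e + G0 e)); last first.
  rewrite (bigID (fun e : cube N => E (val e))) /= mulrC; congr (_ * _).
    rewrite big_mkcond [RHS]big_mkcond; apply: eq_bigr => e _; rewrite /G1 /G0.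
    case: ifP => [/negbTE ->|/negbFE eE]; first by case: ifP; rewrite ?addr0 ?add0r.
    case: ifP => // eD; move/subsetP: DX => /(_ e eD); rewrite inE => eX.
    by move: (EX eE); rewrite eX.
  by apply: eq_bigr => e eE; rewrite /G1 /G0 eE.
rewrite bigA_distr big_mkcond; apply: eq_bigr => I _.
case: ifP => [/forallP ok|/negbT/forallPn[x bad]].
  rewrite big_mkcond; apply: eq_bigr => x _; move: (ok x).
  rewrite /compatible /G1 /G0; case: ifP => _; case: ifP => _.
  - by move->. - by move->. - by case: ifP. by case: ifP.
(* A single incompatible point kills the term of [I]. *)
rewrite (bigD1 x) //= (_ : (if _ then _ else _) = 0) ?mul0r //.
move: bad; rewrite /compatible /G1 /G0; case: ifP => _; case: ifP => _.
- by move/negbTE ->. - by move/negbTE ->. - by move/negPn ->. by move/negPn ->.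
Qed.

End Bipartite.

Lemma cube_sub k N (r s t : int) : (k <= N)%N ->
  Qpred (k%:Z + 1) (r, s, t) -> ((r, s, t) : triple) \in cube N.
Proof. by rewrite /Qpred mem_cube; lia. Qed.

(** Membership, extended by false outside the cube: neighbours of a point can be tested without
    proving that they lie in the cube. *)
Definition inside N (D : {set cube N}) (x : triple) : bool :=
  oapp (fun i => i \in D) false (insub x).

Lemma inside_val N (D : {set cube N}) (x : cube N) : inside D (val x) = (x \in D).
Proof. by rewrite /inside valK. Qed.

Lemma insideP N (D : {set cube N}) (x : triple) :
  reflect (exists2 z : cube N, z \in D & x = val z) (inside D x).
Proof.
rewrite /inside; case: insubP => [z _ zx|nx] /=; last first.
  by constructor=> -[z _ xz]; move: nx; rewrite xz (valP z).
rewrite -zx; apply: (iffP idP) => [zD|[z' z'D /val_inj -> //]].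
by exists z.
Qed.

Section ProdCube.
Variables (R : comNzRingType) (N : nat).

(** Points of [B] that are not shifts of points of [A] receive the factor 1; products over different
    sets can thus be merged over a single index set. *)
Lemma prod_shift (A B : pred triple) (f f' : triple -> triple) (g : triple -> R) :
  cancel f f' -> cancel f' f ->
  {subset A <= cube N} -> {subset B <= cube N} -> (forall x, A x -> B (f x)) ->
  \prod_(x : cube N | A (val x)) g (f (val x)) =
  \prod_(e : cube N | B (val e)) (if A (f' (val e)) then g (val e) else 1).
Proof.
move=> fK f'K sA sB AB; rewrite -big_mkcondr.
(* The default value of [insubd] is taken only when the shift leaves the cube, which cannot happen
   where [h] and [h'] are evaluated below. *)
pose h (x : cube N) := insubd x (f (val x)).
pose h' (x : cube N) := insubd x (f' (val x)).
have hE x : A (val x) -> val (h x) = f (val x).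
  by move=> Ax; rewrite /h insubdK //; apply/sB/AB.
rewrite [RHS](reindex_onto h h') /=.
  apply: eq_big => [x|x Ax]; last by rewrite hE.
  apply/idP/andP => [Ax|[/andP[_ Ah] /eqP hx]].
    rewrite hE // fK AB //; split=> //; apply/eqP/val_inj.
    by rewrite /h' insubdK hE // fK //; apply: sA.
  have : val (h' (h x)) = f' (val (h x)) by rewrite insubdK //; apply: sA.
  by rewrite hx => ->.
move=> e /andP[Be Ae]; apply: val_inj.
have e1 : val (h' e) = f' (val e) by rewrite insubdK //; apply: sA.
by rewrite hE e1 // f'K.
Qed.

Lemma prod_cube_seq (A : pred triple) (s : seq triple) (g : triple -> R) :
  uniq s -> s =i A -> {subset A <= cube N} ->
  \prod_(e : cube N | A (val e)) g (val e) = \prod_(x <- s) g x.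
Proof.
move=> us sA AN; transitivity (\prod_(x <- [seq val e | e : cube N <- index_enum (cube N) & A (val e)]) g x).
  by rewrite big_map big_filter.
apply: perm_big.
apply: uniq_perm => //.
  by rewrite map_inj_uniq ?filter_uniq ?index_enum_uniq //; apply: val_inj.
move=> x; rewrite sA; apply/mapP/idP => [[e]|Ax]; first by rewrite mem_filter => /andP[? _] ->.
by exists [` AN _ Ax]%fset; rewrite // mem_filter mem_index_enum andbT.
Qed.

End ProdCube.

Lemma covers_up (r s t r' s' t' : int) : covers (r', s', t') (r, s, t) ->
  [\/ (r', s', t') = (r + 1, s, t + 1), (r', s', t') = (r - 1, s, t + 1),
      (r', s', t') = (r, s + 1, t + 1) | (r', s', t') = (r, s - 1, t + 1)].
Proof.
rewrite /covers => /andP[/eqP -> c].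
have [|] : (r' = r \/ s' = s) by lia.
  move=> e; rewrite e in c *; have [->|->] : s' = s + 1 \/ s' = s - 1 by lia.
    exact: Or43. exact: Or44.
move=> e; rewrite e in c *; have [->|->] : r' = r + 1 \/ r' = r - 1 by lia.
  exact: Or41. exact: Or42.
Qed.

(* [u1], [u2] (resp. [d1], [d2]) say whether the elements above (resp. below) [e]
   are in [D], and [X1], [X2] whether those below exist at all.  The right-hand
   side collects the factors that the [D]-part and the [Q_k]-part of the shuffled
   weight contribute to [e]. *)
Lemma toggle_factor (R : fieldType) (v : R) (u1 u2 X1 X2 d1 d2 : bool) : v != 0 -> 1 + v != 0 ->
  (d1 ==> X1) -> (d2 ==> X2) -> (u1 || u2 ==> (X1 ==> d1) && (X2 ==> d2)) ->
  (if (X1 ==> d1) && (X2 ==> d2) then v else 0) + (if u1 || u2 then 0 else 1) =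
  (if ~~ X1 && ~~ X2 then 1 + v else 1) *
  ((if u1 then v / (1 + v) else 1) * (if u2 then v / (1 + v) else 1) *
   (if d1 then 1 + v else 1) * (if d2 then 1 + v else 1) *
   (if u1 && u2 then (1 + v) / v else 1) *
   (if X1 && X2 && (d1 || d2) then (1 + v)^-1 else 1)).
Proof.
move=> v0 v10; case: X1; case: d1; case: X2; case: d2; case: u1; case: u2 => //= _ _ _;
  by field; rewrite ?v0 ?v10.
Qed.

(** * Domino shuffling for a fixed trace [D] on Q_{k+1} *)

Section Shuffle.
Variables (k N : nat).
Hypothesis kN : (k.+1 <= N)%N.
Implicit Types (D : {set cube N}).

Local Notation Qs i := (Qpred (k%:Z + i)).

Variables (D : {set cube N}).
Hypothesis DX : forall x, inside D x -> Qs 1 x.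

(** The congruences modulo 4 select the directions: seen from Q_{k+2}, the elements of Q_{k+1} above
    are [r]-neighbours and those below are [s]-neighbours. Seen from Q_k the two directions are
    exchanged. *)
Lemma forced_top (e : cube N) (r s t : int) : val e = (r, s, t) -> Qs 2 (r, s, t) ->
  forced D e = inside D (r + 1, s, t + 1) || inside D (r - 1, s, t + 1).
Proof.
move=> ve Qe; rewrite /forced ve; apply/exists_inP/idP => [[x xD]|].
  have := DX (x := val x); rewrite inside_val => /(_ xD).
  move: xD; rewrite -inside_val; case: (val x) => [[r' s'] t'] xD Qx cx.
  move: Qe Qx xD; rewrite /Qpred.
  by case/covers_up: cx => -[-> -> ->]; [move=> _ _ ->| move=> _ _ ->; rewrite orbT | lia | lia].
by case/orP => /insideP[x xD xe]; exists x => //; rewrite -xe /covers; lia.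
Qed.

Lemma forced_bot (e : cube N) (r s t : int) : val e = (r, s, t) -> Qs 0 (r, s, t) ->
  forced D e = inside D (r, s + 1, t + 1) || inside D (r, s - 1, t + 1).
Proof.
move=> ve Qe; rewrite /forced ve; apply/exists_inP/idP => [[x xD]|].
  have := DX (x := val x); rewrite inside_val => /(_ xD).
  move: xD; rewrite -inside_val; case: (val x) => [[r' s'] t'] xD Qx cx.
  move: Qe Qx xD; rewrite /Qpred.
  by case/covers_up: cx => -[-> -> ->]; [lia | lia | move=> _ _ -> | move=> _ _ ->; rewrite orbT].
by case/orP => /insideP[x xD xe]; exists x => //; rewrite -xe /covers; lia.
Qed.

Lemma Qs1_cube x : Qs 1 x -> x \in cube N.
Proof. by case: x => [[r s] t] Qx; apply: cube_sub Qx; apply: ltnW. Qed.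

(** At the lower boundary of Q_{k+2} an [s]-neighbour below may be missing from Q_{k+1}, hence the
    implications. Below an element of Q_k both [r]-neighbours exist, so [allowed_bot] has none. *)
Lemma allowed_top (e : cube N) (r s t : int) : val e = (r, s, t) -> Qs 2 (r, s, t) ->
  allowed (Qs 1) D e = (Qs 1 (r, s + 1, t - 1) ==> inside D (r, s + 1, t - 1)) &&
                       (Qs 1 (r, s - 1, t - 1) ==> inside D (r, s - 1, t - 1)).
Proof.
move=> ve Qe; rewrite /allowed ve; apply/forallP/andP => [al|[al1 al2] x].
  have {}al z : Qs 1 z -> covers (r, s, t) z -> inside D z.
    move=> Qz cz; move/implyP: (al [` Qs1_cube Qz]%fset).
    by rewrite -inside_val; apply; apply/andP.
  by split; apply/implyP => Qz; apply: al => //; rewrite /covers; lia.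
rewrite -inside_val; case: (val x) => [[r' s'] t']; apply/implyP => /andP[Qx cx].
have := covers_up cx => -[] [er es et].
- by move: Qe Qx; rewrite /Qpred; lia.
- by move: Qe Qx; rewrite /Qpred; lia.
- have <- : (r, s - 1, t - 1) = (r', s', t') by congr (_, _, _); lia.
  by apply: (implyP al2); move: Qx; congr (Qs 1 _); congr (_, _, _); lia.
- have <- : (r, s + 1, t - 1) = (r', s', t') by congr (_, _, _); lia.
  by apply: (implyP al1); move: Qx; congr (Qs 1 _); congr (_, _, _); lia.
Qed.

Lemma allowed_bot (e : cube N) (r s t : int) : val e = (r, s, t) -> Qs 0 (r, s, t) ->
  allowed (Qs 1) D e = inside D (r + 1, s, t - 1) && inside D (r - 1, s, t - 1).
Proof.
move=> ve Qe; rewrite /allowed ve; apply/forallP/andP => [al|[al1 al2] x].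
  have {}al z : Qs 1 z -> covers (r, s, t) z -> inside D z.
    move=> Qz cz; move/implyP: (al [` Qs1_cube Qz]%fset).
    by rewrite -inside_val; apply; apply/andP.
  by split; apply: al; rewrite /covers; move: Qe; rewrite /Qpred; lia.
rewrite -inside_val; case: (val x) => [[r' s'] t']; apply/implyP => /andP[Qx cx].
have := covers_up cx => -[] [er es et].
- by have <- : (r - 1, s, t - 1) = (r', s', t') by congr (_, _, _); lia.
- by have <- : (r + 1, s, t - 1) = (r', s', t') by congr (_, _, _); lia.
- by move: Qe Qx; rewrite /Qpred; lia.
- by move: Qe Qx; rewrite /Qpred; lia.
Qed.

(** At such an element both summands of its factor are 0, so [D] extends to no ideal. *)
Definition clash (P : pred triple) :=
  [exists e : cube N, P (val e) && forced D e && ~~ allowed (Qs 1) D e].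

(* If [(r', s, t + 1)] in [D] lies above [e = (r, s, t)] and [(r, s', t - 1)],
   not in [D], below it, then [(r', s', t)] is a clash of the other kind. *)
Lemma clash_top_bot : clash (Qs 2) = clash (Qs 0).
Proof.
apply/existsP/existsP => -[e]; case ve: (val e) => [[r s] t] /andP[/andP[Qe]].
  rewrite (forced_top ve Qe) (allowed_top ve Qe) negb_and !negb_imply.
  have bad r' s' : inside D (r', s, t + 1) -> `|r' - r| = 1 ->
      Qs 1 (r, s', t - 1) -> ~~ inside D (r, s', t - 1) -> `|s' - s| = 1 ->
      exists x : cube N, Qs 0 (val x) && forced D x && ~~ allowed (Qs 1) D x.
    move=> uD dr Qd dD ds.
    have Qx : Qs 0 (r', s', t).
      by move: (DX uD) Qd; rewrite /Qpred; lia.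
    have xN : ((r', s', t) : triple) \in cube N.
      by move: Qx; rewrite /Qpred mem_cube; lia.
    exists [` xN]%fset; rewrite (_ : Qs 0 _) // (@forced_bot [` xN]%fset _ _ _ erefl Qx).
    rewrite (@allowed_bot [` xN]%fset _ _ _ erefl Qx) negb_and.
    apply/andP; split.
      have [es|es] : s' + 1 = s \/ s' - 1 = s by lia.
        by rewrite es uD. by rewrite es uD orbT.
    have [er|er] : r' + 1 = r \/ r' - 1 = r by lia.
      by rewrite er dD. by rewrite er dD orbT.
  by case/orP => uD /orP[] /andP[Qd dD]; apply: (bad _ _ uD _ Qd dD); lia.
rewrite (forced_bot ve Qe) (allowed_bot ve Qe) negb_and.
have bad r' s' : inside D (r, s', t + 1) -> `|r' - r| = 1 ->
      ~~ inside D (r', s, t - 1) -> `|s' - s| = 1 ->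
      exists x : cube N, Qs 2 (val x) && forced D x && ~~ allowed (Qs 1) D x.
  move=> uD dr dD ds.
  have Qx : Qs 2 (r', s', t).
    by move: (DX uD) Qe; rewrite /Qpred; lia.
  have xN : ((r', s', t) : triple) \in cube N.
    by move: Qx; rewrite /Qpred mem_cube; lia.
  have Qd : Qs 1 (r', s, t - 1) by move: Qe; rewrite /Qpred; lia.
  exists [` xN]%fset; rewrite (_ : Qs 2 _) // (@forced_top [` xN]%fset _ _ _ erefl Qx).
  rewrite (@allowed_top [` xN]%fset _ _ _ erefl Qx) negb_and !negb_imply.
  apply/andP; split.
    have [er|er] : r' + 1 = r \/ r' - 1 = r by lia.
      by rewrite er uD. by rewrite er uD orbT.
  have [es|es] : s' + 1 = s \/ s' - 1 = s by lia.
    by rewrite es dD Qd. by rewrite es dD Qd orbT.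
by case/orP => uD /orP[] dD; apply: (bad _ _ uD _ dD); lia.
Qed.

Variables (R : realType) (y y' : int -> R) (j : int).
(** The weight of (r, s, t) is taken at the index 3r + s + j, which has the parity of j + k on Q_k
    and Q_{k+2}, and the other parity on Q_{k+1}. So [y'_even] governs Q_k and [y'_odd] governs
    [D]. *)
Hypothesis y_neq0 : forall i : int, (2 %| i - (j + k%:Z))%Z -> y i != 0.
Hypothesis y1_neq0 : forall i : int, (2 %| i - (j + k%:Z))%Z -> 1 + y i != 0.
Hypothesis y'_even : forall i : int, (2 %| i - (j + k%:Z))%Z -> y' i = (y i)^-1.
Hypothesis y'_odd : forall i : int, ~~ (2 %| i - (j + k%:Z))%Z ->
  y' i = y (i - 3) * y i * y (i + 3) *
         ((1 + y (i - 1)) * (1 + y (i + 1)) / ((1 + y (i - 3)) * (1 + y (i + 3)))).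

(** On Q_{k+2} these elements have nothing below them in Q_{k+1}; they are the source of the
    prefactor in the shuffling identity. *)
Definition bottom (x : triple) : bool := let: (r, s, t) := x in
  ~~ Qs 1 (r, s + 1, t - 1) && ~~ Qs 1 (r, s - 1, t - 1).

Let prod_inside (g : triple -> R) :
  \prod_(x in D) g (val x) = \prod_(x : cube N | inside D (val x)) g (val x).
Proof. by apply: eq_bigl => x; rewrite inside_val. Qed.

Let Qs2_cube : {subset Qs 2 <= cube N}.
Proof. by move=> [[r s] t]; rewrite mem_cube => Q; move: Q; rewrite unfold_in /= ; lia. Qed.

Let inside_cube : {subset inside D <= cube N}.
Proof. by move=> x Dx; apply/Qs1_cube/DX. Qed.

Let prod_inside_shift (f f' : triple -> triple) (g : triple -> R) :
  cancel f f' -> cancel f' f -> (forall x, Qs 1 x -> Qs 2 (f x)) ->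
  \prod_(x in D) g (f (val x)) =
  \prod_(e : cube N | Qs 2 (val e)) (if inside D (f' (val e)) then g (val e) else 1).
Proof.
move=> fK f'K Qf; rewrite (prod_inside (g \o f)).
exact: (prod_shift g fK f'K inside_cube Qs2_cube (fun x Dx => Qf x (DX Dx))).
Qed.

Let w := weight y j.
Let w' := weight y' j.

(* All factors of the right-hand side are moved to the elements [e] of [Q_{k+2}]
   by the shifts [s1], ..., [s6]: the neighbours of [e] in [Q_{k+1}] for the
   weights [w'] of [D], and [e + (0, 0, 2)], [e - (0, 0, 2)] in [Q_k], which are
   allowed (resp. forced) according to the elements above (resp. below) [e]. *)
Lemma shuffle_term :
  (\prod_(x in D) w (val x)) *
  \prod_(e : cube N | Qs 2 (val e))
     ((if allowed (Qs 1) D e then w (val e) else 0) + (if forced D e then 0 else 1)) =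
  \prod_(e : cube N | Qs 2 (val e)) (if bottom (val e) then 1 + w (val e) else 1) *
  ((\prod_(x in D) w' (val x)) *
  \prod_(e : cube N | Qs 0 (val e))
     ((if allowed (Qs 1) D e then w' (val e) else 0) + (if forced D e then 0 else 1))).
Proof.
have clash0 (P : pred triple) (v : triple -> R) : clash P ->
    \prod_(e : cube N | P (val e))
     ((if allowed (Qs 1) D e then v (val e) else 0) + (if forced D e then 0 else 1)) = 0.
  case/existsP => e /andP[/andP[Pe fe] /negbTE ae].
  by rewrite (bigD1 e) //= ae fe addr0 mul0r.
(* A clash in one layer forces one in the other, and then both sides are 0. *)
have [cl|ncl] := boolP (clash (Qs 2)).
  by rewrite !clash0 -?clash_top_bot // !mulr0.
have ncl0 : ~~ clash (Qs 0) by rewrite -clash_top_bot.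
have ok_top e : Qs 2 (val e) -> forced D e ==> allowed (Qs 1) D e.
  move=> Qe; apply/implyP => fe; apply/negPn/negP => ae; case/negP: ncl.
  by apply/existsP; exists e; rewrite Qe fe ae.
have ok_bot e : Qs 0 (val e) -> forced D e ==> allowed (Qs 1) D e.
  move=> Qe; apply/implyP => fe; apply/negPn/negP => ae; case/negP: ncl0.
  by apply/existsP; exists e; rewrite Qe fe ae.
pose s1 (x : triple) : triple := let: (r, s, t) := x in (r + 1, s, t - 1).
pose s1' (x : triple) : triple := let: (r, s, t) := x in (r - 1, s, t + 1).
pose s2 (x : triple) : triple := let: (r, s, t) := x in (r - 1, s, t - 1).
pose s2' (x : triple) : triple := let: (r, s, t) := x in (r + 1, s, t + 1).
pose s3 (x : triple) : triple := let: (r, s, t) := x in (r, s + 1, t + 1).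
pose s3' (x : triple) : triple := let: (r, s, t) := x in (r, s - 1, t - 1).
pose s4 (x : triple) : triple := let: (r, s, t) := x in (r, s - 1, t + 1).
pose s4' (x : triple) : triple := let: (r, s, t) := x in (r, s + 1, t - 1).
pose s5 (x : triple) : triple := let: (r, s, t) := x in (r, s, t - 2).
pose s6 (x : triple) : triple := let: (r, s, t) := x in (r, s, t + 2).
pose G x := w x / (1 + w x).
pose H x := 1 + w x.
pose K x := (1 + w x) / w x.
pose L x := (1 + w x)^-1.
(* Weights ignore [t], so the heights of the shifts are free and are chosen to land in Q_{k+2}: [G]
   sits at the two elements below [x], [H] at the two above it. *)
have w'D : \prod_(x in D) w' (val x) =
    (\prod_(x in D) w (val x)) *
    ((\prod_(x in D) G (s1 (val x))) * (\prod_(x in D) G (s2 (val x))) *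
     (\prod_(x in D) H (s3 (val x))) * (\prod_(x in D) H (s4 (val x)))).
  rewrite -!big_split; apply: eq_bigr => x; cbv beta; rewrite -inside_val => /DX.
  case: (val x) => [[r s] t]; rewrite /G /H /w /w' /weight /= => Qx.
  rewrite y'_odd; last by move: Qx; rewrite /Qpred; lia.
  rewrite (_ : 3 * (r - 1) + s + j = 3 * r + s + j - 3); last by lia.
  rewrite (_ : 3 * (r + 1) + s + j = 3 * r + s + j + 3); last by lia.
  rewrite (_ : 3 * r + (s - 1) + j = 3 * r + s + j - 1); last by lia.
  rewrite (_ : 3 * r + (s + 1) + j = 3 * r + s + j + 1); last by lia.
  rewrite invfM; ring.
pose A5 (x : triple) := let: (r, s, t) := x in
  [&& Qs 0 x, inside D (r + 1, s, t - 1) & inside D (r - 1, s, t - 1)].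
pose A6 (x : triple) := let: (r, s, t) := x in
  Qs 0 x && (inside D (r, s + 1, t + 1) || inside D (r, s - 1, t + 1)).
(* Without clash the factor of an element of Q_k is 1 if it is not allowed, 1 + 1/w = [K] if it is
   allowed but not forced, and 1/w = [K] times [L] if it is forced. *)
have w'Q : \prod_(e : cube N | Qs 0 (val e))
     ((if allowed (Qs 1) D e then w' (val e) else 0) + (if forced D e then 0 else 1)) =
    (\prod_(e : cube N | A5 (val e)) K (s5 (val e))) *
    (\prod_(e : cube N | A6 (val e)) L (s6 (val e))).
  rewrite [in RHS]big_mkcond [X in _ * X]big_mkcond -big_split big_mkcond.
  apply: eq_bigr => e _; cbv beta; have := ok_bot e.
  case ve: (val e) => [[r s] t]; rewrite /A5 /A6.
  case: ifP => [Qe|_ _]; last by rewrite /= mulr1.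
  have yp : (2 %| 3 * r + s + j - (j + k%:Z))%Z by move: Qe; rewrite /Qpred; lia.
  move=> /(_ isT); rewrite (forced_bot ve Qe) (allowed_bot ve Qe) /=.
  have y0 := y_neq0 yp; have y10 := y1_neq0 yp.
  rewrite /K /L /w /w' /weight /= (y'_even yp).
  case: (_ && _); case: (_ || _) => //= _; by field; rewrite ?y0 ?y10.
rewrite w'D w'Q.
rewrite (@prod_inside_shift s1 s1' G); first last.
- by case=> [[r s] t]; rewrite /Qpred /=; lia.
- by case=> [[r s] t]; congr (_, _, _); lia.
- by case=> [[r s] t]; congr (_, _, _); lia.
rewrite (@prod_inside_shift s2 s2' G); first last.
- by case=> [[r s] t]; rewrite /Qpred /=; lia.
- by case=> [[r s] t]; congr (_, _, _); lia.
- by case=> [[r s] t]; congr (_, _, _); lia.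
rewrite (@prod_inside_shift s3 s3' H); first last.
- by case=> [[r s] t]; rewrite /Qpred /=; lia.
- by case=> [[r s] t]; congr (_, _, _); lia.
- by case=> [[r s] t]; congr (_, _, _); lia.
rewrite (@prod_inside_shift s4 s4' H); first last.
- by case=> [[r s] t]; rewrite /Qpred /=; lia.
- by case=> [[r s] t]; congr (_, _, _); lia.
- by case=> [[r s] t]; congr (_, _, _); lia.
rewrite (@prod_shift R N A5 (Qs 2) s5 s6 K) //; first last.
- by case=> [[r s] t]; rewrite /A5 /Qpred /=; lia.
- by case=> [[r s] t]; rewrite mem_cube unfold_in /A5 /Qpred /=; lia.
- by case=> [[r s] t]; congr (_, _, _); lia.
- by case=> [[r s] t]; congr (_, _, _); lia.
rewrite (@prod_shift R N A6 (Qs 2) s6 s5 L) //; first last.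
- by case=> [[r s] t]; rewrite /A6 /Qpred /=; lia.
- by case=> [[r s] t]; rewrite mem_cube unfold_in /A6 /Qpred /=; lia.
- by case=> [[r s] t]; congr (_, _, _); lia.
- by case=> [[r s] t]; congr (_, _, _); lia.
rewrite [RHS]mulrCA -!mulrA; congr (_ * _); rewrite -!big_split.
apply: eq_bigr => e Qe; cbv beta; have := ok_top e Qe.
case ve: (val e) Qe => [[r s] t] Qe.
rewrite (forced_top ve Qe) (allowed_top ve Qe).
have yp : (2 %| 3 * r + s + j - (j + k%:Z))%Z by move: Qe; rewrite /Qpred; lia.
have y0 := y_neq0 yp; have y10 := y1_neq0 yp.
(* Membership in Q_k can be read off the neighbours of [e]: it is automatic when both elements above
   [e] are in [D], and for [A6E] it amounts to both elements below [e] being in Q_{k+1}. *)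
have A5E : A5 (s6 (r, s, t)) = inside D (r + 1, s, t + 1) && inside D (r - 1, s, t + 1).
  rewrite /A5 /s6 (_ : t + 2 - 1 = t + 1); last by lia.
  by apply: andb_idl => /andP[/DX u1 /DX u2]; move: u1 u2 Qe; rewrite /Qpred; lia.
have A6E : A6 (s5 (r, s, t)) = Qs 1 (r, s + 1, t - 1) && Qs 1 (r, s - 1, t - 1) &&
    (inside D (r, s + 1, t - 1) || inside D (r, s - 1, t - 1)).
  rewrite /A6 /s5 (_ : t - 2 + 1 = t - 1); last by lia.
  by congr (_ && _); move: Qe; rewrite /Qpred; lia.
move=> ok; rewrite toggle_factor //; try by apply/implyP/DX.
rewrite A5E A6E /bottom /s1' /s2' /s3' /s4' /G /H /K /L.
have mulAC (a b c d e1 f g : R) :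
  a * (b * c * d * e1 * f * g) = c * (b * (e1 * (d * (a * (f * g))))) by ring.
exact: mulAC.
Qed.

End Shuffle.

Lemma eq_ideal_in (P P' : pred triple) N (I : {set cube N}) :
  P =1 P' -> ideal_in P I = ideal_in P' I.
Proof.
move=> PP'; apply: eq_forallb => x; congr (_ ==> (_ && _)); first exact: PP'.
by apply: eq_forallb => z; rewrite PP'.
Qed.

(** This parity separates consecutive layers, and every cover changes it; hence covers never stay
    inside a layer. *)
Lemma Qpred_parity (m r s t : int) : Qpred m (r, s, t) -> (2 %| r + s + m)%Z.
Proof. by rewrite /Qpred; lia. Qed.

Lemma Qpred_disjoint (m : int) x : Qpred (m + 1) x -> ~~ Qpred m x.
Proof. by case: x => [[r s] t] /Qpred_parity p; apply/negP => /Qpred_parity; lia. Qed.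

Lemma covers_Qpred (m : int) x z : covers x z -> Qpred m x -> ~~ Qpred m z.
Proof.
case: x z => [[r s] t] [[r' s'] t'] /covers_up c /Qpred_parity p.
by apply/negP => /Qpred_parity p'; case: c => -[? ? ?]; lia.
Qed.

(** The bottom elements of Q_{k+2} are exactly the (i, 0, -k) with |i| <= k and i of the parity of
    k. *)
Lemma prod_bottom (R : realType) (y : int -> R) (j : int) k :
  \prod_(e : cube k.+1 | Qpred (k%:Z + 2) (val e))
     (if bottom k (val e) then 1 + weight y j (val e) else 1) =
  \prod_(i <- zrange k | (2 %| i + k%:Z)%Z) (1 + y (j + 3 * i)).
Proof.
pose bot (i : int) : triple := (i, 0, - k%:Z).
pose A x := Qpred (k%:Z + 2) x && bottom k x.
rewrite -big_mkcondr -[RHS]big_filter.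
rewrite (@prod_cube_seq R k.+1 A (map bot [seq i <- zrange k | (2 %| i + k%:Z)%Z])
  (fun x => 1 + weight y j x)).
- rewrite big_map; apply: eq_bigr => i _; rewrite /weight /=; congr (1 + y _); lia.
- rewrite map_inj_uniq; last by move=> a b [].
  rewrite filter_uniq // /zrange map_inj_uniq ?iota_uniq // => a b; lia.
- case=> [[r s] t]; rewrite unfold_in.
  apply/mapP/idP => [[i]|].
    rewrite mem_filter mem_zrange /A /bottom /Qpred => /andP[ik ii] [-> -> ->]; lia.
  rewrite /A /bottom /Qpred => Ax; exists r; first by rewrite mem_filter mem_zrange; lia.
  by rewrite /bot; congr (_, _, _); lia.
- case=> [[r s] t]; rewrite mem_cube unfold_in /A => /andP[Q _].
  by move: Q; rewrite /Qpred; lia.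
Qed.

Lemma Fpoly_shuffle (R : realType) (y y' : int -> R) (j : int) k :
  (forall i : int, (2 %| i - (j + k%:Z))%Z -> y i != 0) ->
  (forall i : int, (2 %| i - (j + k%:Z))%Z -> 1 + y i != 0) ->
  (forall i : int, (2 %| i - (j + k%:Z))%Z -> y' i = (y i)^-1) ->
  (forall i : int, ~~ (2 %| i - (j + k%:Z))%Z ->
     y' i = y (i - 3) * y i * y (i + 3) *
       ((1 + y (i - 1)) * (1 + y (i + 1)) / ((1 + y (i - 3)) * (1 + y (i + 3))))) ->
  Fpoly y j k.+1 =
  (\prod_(i <- zrange k | (2 %| i + k%:Z)%Z) (1 + y (j + 3 * i))) * Fpoly y' j k.
Proof.
move=> y0 y10 y'e y'o.
rewrite (Fpoly_cube y j (leqnn k.+1)) (Fpoly_cube y' j (leqnSn k)).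
have PE : mem (Pset k.+1) =1 predU (Qpred (k%:Z + 2)) (Qpred (k%:Z + 1)).
  by move=> x; rewrite /= in_Pset; congr (Qpred _ _ || Qpred _ _); lia.
have PE' : mem (Pset k) =1 predU (Qpred (k%:Z + 0)) (Qpred (k%:Z + 1)).
  by move=> x; rewrite /= in_Pset orbC addr0.
rewrite (eq_bigl _ _ (fun I => eq_ideal_in I PE)).
rewrite (eq_bigl _ _ (fun I => eq_ideal_in I PE')).
have disj2 x : Qpred (k%:Z + 2) x -> ~~ Qpred (k%:Z + 1) x.
  by rewrite (_ : k%:Z + 2 = k%:Z + 1 + 1); [apply: Qpred_disjoint | lia].
have disj0 x : Qpred (k%:Z + 0) x -> ~~ Qpred (k%:Z + 1) x.
  by rewrite addr0; apply: contraL; apply: Qpred_disjoint.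
have cov m := @covers_Qpred m.
rewrite (sum_ideal_bipartite _ _ disj2 (cov _) (cov _)).
rewrite (sum_ideal_bipartite _ _ disj0 (cov _) (cov _)).
rewrite big_distrr; apply: eq_bigr => D /subsetP DX.
rewrite (@shuffle_term k k.+1 (leqnn _) D _ R y y' j) // ?prod_bottom //.
by move=> x /insideP[z /DX + ->]; rewrite inE.
Qed.

(** * The projective plane in homogeneous coordinates *)

Section Vectors.
Variable R : realType.
Implicit Types (u v w x y z n p q a b c d : 'rV[R]_3) (L : subspace R).

Local Notation o0 := (Ordinal (isT : (0 < 3)%N)).
Local Notation o1 := (Ordinal (isT : (1 < 3)%N)).
Local Notation o2 := (Ordinal (isT : (2 < 3)%N)).

Definition dotp u v : R := u 0 o0 * v 0 o0 + u 0 o1 * v 0 o1 + u 0 o2 * v 0 o2.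

Definition crossp u v : 'rV[R]_3 :=
  \row_i [:: u 0 o1 * v 0 o2 - u 0 o2 * v 0 o1;
             u 0 o2 * v 0 o0 - u 0 o0 * v 0 o2;
             u 0 o0 * v 0 o1 - u 0 o1 * v 0 o0]`_i.

Definition det3 u v w : R := dotp u (crossp v w).

Lemma rV3P u v : u 0 o0 = v 0 o0 -> u 0 o1 = v 0 o1 -> u 0 o2 = v 0 o2 -> u = v.
Proof.
move=> e0 e1 e2; apply/rowP => -[[|[|[|//]]] i3].
- by rewrite (_ : Ordinal i3 = o0) //; apply: val_inj.
- by rewrite (_ : Ordinal i3 = o1) //; apply: val_inj.
- by rewrite (_ : Ordinal i3 = o2) //; apply: val_inj.
Qed.

Lemma dotp_mx u v : u *m v^T = (dotp u v)%:M.
Proof.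
apply/matrixP => i j; rewrite !ord1 !mxE !big_ord_recl big_ord0 !mxE /= addr0 addrA.
by rewrite /dotp mulr1n; congr (_ * _ + _ * _ + _ * _); congr (_ _ _); apply: val_inj.
Qed.

Lemma dotpp_eq0 u : (dotp u u == 0) = (u == 0).
Proof.
apply/eqP/eqP => [uu|->]; last by rewrite /dotp !mxE; ring.
by apply: rV3P; rewrite !mxE; move: uu; rewrite /dotp => uu; nra.
Qed.

Ltac vec := rewrite /det3 /dotp /crossp ?mxE /=; ring.
Ltac vec3 := apply: rV3P; vec.

Lemma crossp_line u v : u != 0 -> crossp u v = 0 -> v \in <[u]>%VS.
Proof.
move=> u0 uv0; apply/vlineP; exists (dotp u v / dotp u u).
have uu0 : dotp u u != 0 by rewrite dotpp_eq0.
(* Expansion of the double cross product, solved for [v] thanks to u.u != 0. *)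
have e : dotp u u *: v = dotp u v *: u - crossp u (crossp u v) by vec3.
apply: (scalerI uu0); rewrite e uv0 scalerA mulrC divfK //.
by rewrite (_ : crossp u 0 = 0) ?subr0 //; vec3.
Qed.

Lemma crossp_neq0 u v : u != 0 -> v != 0 -> <[u]>%VS != <[v]>%VS -> crossp u v != 0.
Proof.
move=> u0 v0; apply: contra_neq => uv0; apply/esym/eqP.
by rewrite eqEdim -memvE crossp_line // !dim_vline u0 v0.
Qed.

Lemma crosspL u v : crossp u v != 0 -> u != 0.
Proof. by apply: contra_neq => ->; vec3. Qed.

Lemma crosspR u v : crossp u v != 0 -> v != 0.
Proof. by apply: contra_neq => ->; vec3. Qed.

Lemma memv_join u v w : crossp u v != 0 ->
  (w \in (<[u]> + <[v]>)%VS) = (det3 u v w == 0).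
Proof.
set n := crossp u v => n0; apply/memv_addP/eqP => [[_ /vlineP[k ->] [_ /vlineP[l ->] ->]]|d0].
  by vec.
have nn0 : dotp n n != 0 by rewrite dotpp_eq0.
exists ((det3 w v n / dotp n n) *: u); first by rewrite memvZ ?memv_line.
exists ((det3 u w n / dotp n n) *: v); first by rewrite memvZ ?memv_line.
(* Coordinates of [w] in the basis u, v, u x v; the third one is the determinant. *)
have e : dotp n n *: w = det3 w v n *: u + det3 u w n *: v + det3 u v w *: n.
  by rewrite /n; vec3.
apply: (scalerI nn0); rewrite e d0 scale0r addr0 scalerDr !scalerA.
by rewrite ![dotp n n * _]mulrC !divfK.
Qed.

Lemma dim_join u v : crossp u v != 0 -> \dim (<[u]> + <[v]>)%VS = 2%N.
Proof.
move=> n0; have u0 := crosspL n0; have v0 := crosspR n0.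
apply/eqP; rewrite eqn_leq; apply/andP; split.
  by apply: leq_trans (dimv_add_leqif _ _) _; rewrite !dim_vline u0 v0.
rewrite ltnNge; apply: contra_neqN n0 => d1.
have /eqP e : <[u]>%VS == (<[u]> + <[v]>)%VS by rewrite eqEdim addvSl dim_vline u0.
have: v \in (<[u]> + <[v]>)%VS by rewrite memvE addvSr.
by rewrite -e => /vlineP[k ->]; vec3.
Qed.

Lemma join_neq u v w : crossp u v != 0 -> crossp u w != 0 ->
  (<[u]> + <[v]>)%VS != (<[u]> + <[w]>)%VS -> det3 u v w != 0.
Proof.
move=> uv uw; apply: contra_neq => d0; apply/esym/eqP.
rewrite eqEdim !dim_join // leqnn andbT subv_add addvSl -memvE memv_join //.
exact/eqP.
Qed.

Lemma join_eq u v w : crossp u v != 0 -> crossp u w != 0 -> det3 u v w = 0 ->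
  (<[u]> + <[v]>)%VS = (<[u]> + <[w]>)%VS.
Proof. by move=> uv uw d0; apply/eqP; apply: contra_eqT d0; apply: join_neq. Qed.

(** The cross product of two lines is their normal vector, and two planes meet along the cross
    product of their normals. *)
Lemma meet_join u v x y : crossp u v != 0 -> crossp x y != 0 ->
  (<[u]> + <[v]>)%VS != (<[x]> + <[y]>)%VS ->
  let z := crossp (crossp u v) (crossp x y) in
  z != 0 /\ ((<[u]> + <[v]>) :&: (<[x]> + <[y]>))%VS = <[z]>%VS.
Proof.
move=> uv xy ne z.
have z0 : z != 0.
  apply: contra_neq ne => z0; apply/esym/eqP; rewrite eqEdim !dim_join // leqnn andbT.
  (* Proportional normals would make the two planes equal. *)
  have /vlineP[k xyE] := crossp_line uv z0.
  have mem w : dotp (crossp x y) w = 0 -> w \in (<[u]> + <[v]>)%VS.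
    move=> dw; rewrite memv_join //; apply/eqP.
    have k0 : k != 0 by apply: contra_neq xy => k0; rewrite xyE k0 scale0r.
    apply: (mulfI k0); rewrite mulr0 -dw xyE; vec.
  by rewrite subv_add -!memvE !mem //; vec.
split=> //; apply/esym/eqP; rewrite eqEdim subv_cap -!memvE !memv_join //.
rewrite dim_vline z0 (_ : det3 u v z = 0); last by rewrite /z; vec.
rewrite (_ : det3 x y z = 0) ?eqxx /=; last by rewrite /z; vec.
rewrite leqNgt; apply: contra_neqN ne => d2.
set U := (<[u]> + <[v]>)%VS; set V := (<[x]> + <[y]>)%VS.
have /eqP eU : (U :&: V)%VS == U by rewrite eqEdim capvSl /U dim_join.
have /eqP eV : (U :&: V)%VS == V by rewrite eqEdim capvSr /V dim_join.
by rewrite -eU {1}eV.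
Qed.

(** * Duality, and cross ratios as quotients of determinants *)

Lemma memv_dual (U : subspace R) x :
  reflect (forall u, u \in U -> dotp x u = 0) (x \in dual U).
Proof.
have -> : (x \in dual U) = all (fun u => dotp x u == 0) (vbasis U).
  rewrite /dual; elim: (tval (vbasis U)) => [|u s IHs]; first by rewrite big_nil memvf.
  rewrite big_cons memv_cap IHs /= memv_ker lfunE /= dotp_mx.
  congr (_ && _); apply/eqP/eqP => [/matrixP/(_ 0 0)|->]; first by rewrite !mxE mulr1n.
  by apply/matrixP => i j; rewrite !mxE mul0rn.
apply: (iffP allP) => [al u uU|al u /vbasis_mem /al -> //].
rewrite (coord_vbasis uU); elim/big_rec: _ => [|i w _ IH]; first by vec.
have /eqP bi : dotp x (vbasis U)`_i == 0 by apply: al; rewrite mem_nth // size_tuple.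
rewrite (_ : dotp _ _ = coord (vbasis U) i u * dotp x (vbasis U)`_i + dotp x w).
  by rewrite bi IH; ring.
by vec.
Qed.

Lemma dual_join u v : crossp u v != 0 -> dual (<[u]> + <[v]>)%VS = <[crossp u v]>%VS.
Proof.
move=> n0; apply/vspaceP => x; apply/memv_dual/idP => [xo|/vlineP[k ->] w].
  apply: crossp_line => //.
  have xu : dotp x u = 0 by rewrite xo // memvE addvSl.
  have xv : dotp x v = 0 by rewrite xo // memvE addvSr.
  rewrite (_ : crossp _ _ = dotp x u *: v - dotp x v *: u); last by vec3.
  by rewrite xu xv !scale0r subr0.
by rewrite memv_join // => /eqP d0; rewrite -[RHS](mulr0 k) -d0; vec.
Qed.

(** The independent vectors p x q and p x q' give the lower bound; p.p != 0 excludes dimension 3. *)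
Lemma dim_dual_point p q q' : det3 p q q' != 0 -> \dim (dual <[p]>%VS) = 2%N.
Proof.
move=> d0; have p0 : p != 0 by apply: contra_neq d0 => ->; vec.
apply/eqP; rewrite eqn_leq; apply/andP; split.
  have: (\dim (dual <[p]>) <= 3)%N.
    by rewrite (leq_trans (dimvS (subvf _))) // dimvf /dim /= mul1n.
  rewrite leq_eqVlt => /orP[/eqP d3|//].
  have /eqP e : dual <[p]>%VS == fullv by rewrite eqEdim subvf d3 dimvf /dim /= mul1n.
  have /memv_dual/(_ p (memv_line p)) /eqP : p \in dual <[p]>%VS by rewrite e memvf.
  by rewrite dotpp_eq0 (negbTE p0).
have ne : crossp (crossp p q) (crossp p q') != 0.
  rewrite (_ : crossp _ _ = det3 p q q' *: p); last by vec3.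
  by rewrite scaler_eq0 negb_or d0.
suff sub : (<[crossp p q]> + <[crossp p q']> <= dual <[p]>)%VS.
  by have := dimvS sub; rewrite (dim_join ne).
rewrite subv_add -!memvE.
by apply/andP; split; apply/memv_dual => _ /vlineP[k ->]; vec.
Qed.

Lemma basis_frame L : \dim L = 2%N -> basis_of L (frame L).
Proof.
move=> d2; rewrite (_ : tval (frame L) = vbasis L) ?vbasisP //=.
have : size (vbasis L) = 2%N by rewrite size_tuple.
by case: (tval (vbasis L)) => [|a [|b []]].
Qed.

(** On L the form [det3 w] is the coordinate bracket up to the constant [det3 w e0 e1], which [x]
    and [y] show to be nonzero. This constant and the scalars of the chosen representatives cancel
    in the quotient. *)
Lemma cross_ratioE L w x y a b c d : \dim L = 2%N ->
  x \in L -> y \in L -> det3 w x y != 0 ->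
  a \in L -> b \in L -> c \in L -> d \in L ->
  a != 0 -> b != 0 -> c != 0 -> d != 0 ->
  cross_ratio L <[a]> <[b]> <[c]> <[d]> =
  (det3 w a b * det3 w c d) / (det3 w a c * det3 w b d).
Proof.
move=> d2 xL yL wxy aL bL cL dL a0 b0 c0 d0.
set e0 := (vbasis L)`_0; set e1 := (vbasis L)`_1.
have dec z : z \in L -> z = coord (frame L) 0 z *: e0 + coord (frame L) 1 z *: e1.
  move=> zL; rewrite {1}(coord_basis (basis_frame d2) zL) !big_ord_recl big_ord0 addr0.
  by congr (_ + _); congr (coord _ _ _ *: _); apply: val_inj.
have D z z' : z \in L -> z' \in L -> det3 w z z' =
    (coord (frame L) 0 z * coord (frame L) 1 z' - coord (frame L) 1 z * coord (frame L) 0 z')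
      * det3 w e0 e1.
  move=> zL z'L; rewrite {1}(dec z zL) {1}(dec z' z'L).
  move: (coord _ 0 z) (coord _ 1 z) (coord _ 0 z') (coord _ 1 z') => *; vec.
have dl0 : det3 w e0 e1 != 0.
  by apply: contra_neq wxy => dl0; rewrite D // dl0 mulr0.
have pick z : z != 0 -> exists2 k, k != 0 & vpick <[z]>%VS = k *: z.
  move=> z0; have /vlineP[k kE] := memv_pick <[z]>%VS; exists k => //.
  have: vpick <[z]>%VS != 0 by rewrite vpick0 -dimv_eq0 dim_vline z0.
  by apply: contra_neq => k0; rewrite kE k0 scale0r.
have B z z' k k' : z \in L -> z' \in L -> vpick <[z]>%VS = k *: z ->
    vpick <[z']>%VS = k' *: z' ->
    bracket L <[z]> <[z']> = k * k' / det3 w e0 e1 * det3 w z z'.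
  move=> zL z'L kE k'E; rewrite /bracket /hcoord kE k'E !linearZ /= (D z z') //.
  move: (det3 w e0 e1) dl0 => dl dl0.
  by move: (coord _ 0 z) (coord _ 1 z) (coord _ 0 z') (coord _ 1 z') => *; field.
have [ka ka0 kaE] := pick a a0; have [kb kb0 kbE] := pick b b0.
have [kc kc0 kcE] := pick c c0; have [kd kd0 kdE] := pick d d0.
rewrite /cross_ratio (B _ _ _ _ aL bL kaE kbE) (B _ _ _ _ cL dL kcE kdE).
rewrite (B _ _ _ _ aL cL kaE kcE) (B _ _ _ _ bL dL kbE kdE).
set dl := det3 w e0 e1.
rewrite mulrACA [X in _ / X]mulrACA.
rewrite (_ : ka * kb / dl * (kc * kd / dl) = ka * kc / dl * (kb * kd / dl)); last by ring.
by rewrite -mulf_div divff ?mul1r // !mulf_neq0 ?invr_eq0.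
Qed.

Lemma pencil_cross_ratioE p a b c d :
  crossp p a != 0 -> crossp p b != 0 -> crossp p c != 0 -> crossp p d != 0 ->
  det3 p a b != 0 ->
  pencil_cross_ratio <[p]> (<[p]> + <[a]>)%VS (<[p]> + <[b]>)%VS
    (<[p]> + <[c]>)%VS (<[p]> + <[d]>)%VS =
  (det3 p a b * det3 p c d) / (det3 p a c * det3 p b d).
Proof.
move=> pa pb pc pd pab; rewrite /pencil_cross_ratio !dual_join //.
have p0 := crosspL pa; have pp0 : dotp p p != 0 by rewrite dotpp_eq0.
have dE x y : det3 p (crossp p x) (crossp p y) = dotp p p * det3 p x y by vec.
have inD x : crossp p x \in dual <[p]>%VS.
  by apply/memv_dual => _ /vlineP[k ->]; vec.
rewrite (@cross_ratioE _ p (crossp p a) (crossp p b)) ?(dim_dual_point pab) //.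
  rewrite !dE mulrACA [X in _ / X]mulrACA.
  by rewrite -mulf_div divff ?mul1r // mulf_neq0.
by rewrite dE mulf_neq0.
Qed.

Lemma side_cross_ratioE p q u v x y :
  crossp p q != 0 -> crossp u v != 0 -> crossp x y != 0 ->
  (<[u]> + <[v]>)%VS != (<[p]> + <[q]>)%VS ->
  (<[x]> + <[y]>)%VS != (<[p]> + <[q]>)%VS ->
  cross_ratio (<[p]> + <[q]>)%VS ((<[u]> + <[v]>) :&: (<[p]> + <[q]>))%VS
    <[p]>%VS <[q]>%VS ((<[x]> + <[y]>) :&: (<[p]> + <[q]>))%VS =
  (det3 u v p * det3 q x y) / (det3 u v q * det3 p x y).
Proof.
move=> pq uv xy uvpq xypq.
have [X0 ->] := meet_join uv pq uvpq; have [Y0 ->] := meet_join xy pq xypq.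
have n0 : dotp (crossp p q) (crossp p q) != 0 by rewrite dotpp_eq0.
rewrite (@cross_ratioE _ (crossp p q) p q) ?dim_join ?memv_join //; first last.
- exact: crosspR pq.
- exact: crosspL pq.
- by apply/eqP; vec.
- by apply/eqP; vec.
- by apply/eqP; vec.
- by apply/eqP; vec.
- by apply/eqP; vec.
- by apply/eqP; vec.
set n := dotp (crossp p q) (crossp p q) in n0.
set X := crossp (crossp u v) _; set Y := crossp (crossp x y) _.
have -> : det3 (crossp p q) X p = n * det3 u v p by rewrite /X /n; vec.
have -> : det3 (crossp p q) q Y = - (n * det3 q x y) by rewrite /Y /n; vec.
have -> : det3 (crossp p q) X q = n * det3 u v q by rewrite /X /n; vec.
have -> : det3 (crossp p q) p Y = - (n * det3 p x y) by rewrite /Y /n; vec.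
rewrite !mulrN invrN mulrNN mulrACA [X in _ / X]mulrACA.
by rewrite -mulf_div divff ?mul1r // mulf_neq0.
Qed.

Lemma det3_cycle u v w : det3 u v w = det3 v w u.
Proof. by vec. Qed.

Lemma det3_swap u v w : det3 u v w = - det3 v u w.
Proof. by vec. Qed.

Lemma crosspC u v : crossp u v = - crossp v u.
Proof. by vec3. Qed.

(** This is (u x v) x (v x w) = [u, v, w] v: lines sharing a point meet there. Applied first to
    lines and then to points, it factors every bracket of the image polygon used below. *)
Lemma det3_crossp u v w x : det3 (crossp u v) (crossp v w) x = det3 u v w * dotp v x.
Proof. by vec. Qed.

Lemma det3_lines c0 c1 c2 c3 c4 :
  det3 (crossp c0 c2) (crossp c1 c3) (crossp c2 c4) = det3 c0 c2 c4 * det3 c1 c2 c3.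
Proof. by rewrite det3_cycle det3_swap -det3_cycle det3_crossp -/(det3 _ _ _) (det3_swap c1) mulrN. Qed.

(** Three-term relation in the pencil through [c], in the form that makes 1 + y a monomial. *)
Lemma det3_pluecker a b c d x :
  det3 a b c * det3 c d x - det3 a c d * det3 b c x = - (det3 a c x * det3 b c d).
Proof. by vec. Qed.

Lemma det3_crossp_last x z v w :
  det3 x (crossp z v) (crossp v w) = det3 z v w * dotp v x.
Proof. by rewrite det3_cycle det3_crossp. Qed.

Lemma det3_crossp_ends x z v w :
  det3 (crossp v w) x (crossp z v) = det3 z v w * dotp v x.
Proof. by rewrite -det3_cycle det3_crossp. Qed.

(** * The two mutation rules as identities between brackets of consecutive vertices *)

Section Octagon.
Variables c0 c1 c2 c3 c4 c5 c6 c7 c8 : 'rV[R]_3.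

Let l0 := crossp c0 c2.
Let l1 := crossp c1 c3.
Let l2 := crossp c2 c4.
Let l3 := crossp c3 c5.
Let l4 := crossp c4 c6.
Let l5 := crossp c5 c7.
Let l6 := crossp c6 c8.
Let b0 := crossp l0 l1.
Let b1 := crossp l1 l2.
Let b2 := crossp l2 l3.
Let b3 := crossp l3 l4.
Let b4 := crossp l4 l5.
Let b5 := crossp l5 l6.

(** Geometrically, the side [b2 b3] lies on [c3 c5], and the lines [b0 b1] and [b4 b5] cut it in
    [c3] and [c5]. Projecting c3, b2, b3, c5 from [c4] gives the lines to c3, c2, c6, c5, whose
    cross ratio is that of the lines to c2, c3, c5, c6. *)
Lemma pentagram_side :
  det3 c0 c2 c4 != 0 -> det3 c1 c3 c5 != 0 -> det3 c3 c5 c7 != 0 -> det3 c4 c6 c8 != 0 ->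
  det3 c1 c2 c3 != 0 -> det3 c2 c3 c4 != 0 -> det3 c4 c5 c6 != 0 -> det3 c5 c6 c7 != 0 ->
  det3 c2 c4 c5 != 0 -> det3 c3 c4 c6 != 0 ->
  - ((det3 b0 b1 b2 * det3 b3 b4 b5) / (det3 b0 b1 b3 * det3 b2 b4 b5)) =
  (- ((det3 c2 c4 c5 * det3 c3 c4 c6) / (det3 c2 c3 c4 * det3 c4 c5 c6)))^-1.
Proof.
move=> n024 n135 n357 n468 n123 n234 n456 n567 n245 n346.
have -> : det3 b0 b1 b2 = det3 c0 c2 c4 * det3 c1 c2 c3 * (det3 c1 c3 c5 * det3 c2 c3 c4).
  by rewrite -!det3_lines /b0 /b1 /b2 det3_crossp.
have -> : det3 b3 b4 b5 = det3 c3 c5 c7 * det3 c4 c5 c6 * (det3 c4 c6 c8 * det3 c5 c6 c7).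
  by rewrite -!det3_lines /b3 /b4 /b5 det3_crossp.
have -> : det3 b0 b1 b3 = det3 c0 c2 c4 * det3 c1 c2 c3 * (det3 c1 c3 c5 * det3 c3 c4 c6).
  rewrite -det3_lines /b0 /b1 /b3 det3_crossp; congr (_ * _).
  exact: det3_crossp.
have -> : det3 b2 b4 b5 = det3 c4 c6 c8 * det3 c5 c6 c7 * (det3 c3 c5 c7 * det3 c2 c4 c5).
  rewrite -det3_lines /b2 /b4 /b5 det3_crossp_last; congr (_ * _).
  by rewrite -/(det3 l5 l2 l3) det3_crossp_ends -/(det3 _ _ _) [det3 c5 _ _]det3_cycle.
field.
by repeat (apply/andP; split).
Qed.

(** For the index j midway between [c3] and [c4], the numbers in [y0], [y3], [y6] are offsets from j
    - 3, and each [z] is the monomial of 1 + y at its offset. Once the brackets of the [b]'s are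
    factored, only cancellation remains. *)
Lemma pentagram_corner :
  det3 c0 c2 c4 != 0 -> det3 c1 c3 c5 != 0 -> det3 c2 c4 c6 != 0 -> det3 c3 c5 c7 != 0 ->
  det3 c0 c1 c2 != 0 -> det3 c1 c2 c3 != 0 -> det3 c2 c3 c4 != 0 -> det3 c3 c4 c5 != 0 ->
  det3 c4 c5 c6 != 0 -> det3 c5 c6 c7 != 0 -> det3 c1 c2 c4 != 0 -> det3 c3 c5 c6 != 0 ->
  let y0 := - ((det3 c0 c2 c3 * det3 c1 c2 c4) / (det3 c0 c1 c2 * det3 c2 c3 c4)) in
  let y3 := - ((det3 c1 c2 c3 * det3 c4 c5 c6) / (det3 c1 c2 c4 * det3 c3 c5 c6)) in
  let y6 := - ((det3 c3 c5 c6 * det3 c4 c5 c7) / (det3 c3 c4 c5 * det3 c5 c6 c7)) in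
  let z0 := - ((det3 c0 c2 c4 * det3 c1 c2 c3) / (det3 c0 c1 c2 * det3 c2 c3 c4)) in
  let z2 := - ((det3 c1 c3 c5 * det3 c2 c3 c4) / (det3 c1 c2 c3 * det3 c3 c4 c5)) in
  let z4 := - ((det3 c2 c4 c6 * det3 c3 c4 c5) / (det3 c2 c3 c4 * det3 c4 c5 c6)) in
  let z6 := - ((det3 c3 c5 c7 * det3 c4 c5 c6) / (det3 c3 c4 c5 * det3 c5 c6 c7)) in
  - ((det3 b0 b2 b3 * det3 b1 b2 b4) / (det3 b0 b1 b2 * det3 b2 b3 b4)) =
  y0 * y3 * y6 * (z2 * z4 / (z0 * z6)).
Proof.
move=> n024 n135 n246 n357 n012 n123 n234 n345 n456 n567 n124 n356 y0 y3 y6 z0 z2 z4 z6.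
have -> : det3 b0 b1 b2 = det3 c0 c2 c4 * det3 c1 c2 c3 * (det3 c1 c3 c5 * det3 c2 c3 c4).
  by rewrite -!det3_lines /b0 /b1 /b2 det3_crossp.
have -> : det3 b2 b3 b4 = det3 c2 c4 c6 * det3 c3 c4 c5 * (det3 c3 c5 c7 * det3 c4 c5 c6).
  by rewrite -!det3_lines /b2 /b3 /b4 det3_crossp.
have -> : det3 b0 b2 b3 = det3 c2 c4 c6 * det3 c3 c4 c5 * (det3 c1 c3 c5 * det3 c0 c2 c3).
  rewrite -det3_lines /b0 /b2 /b3 det3_crossp_last; congr (_ * _).
  by rewrite -/(det3 l3 l0 l1) det3_crossp_ends -/(det3 _ _ _) [det3 c3 c0 _]det3_cycle.
have -> : det3 b1 b2 b4 = det3 c1 c3 c5 * det3 c2 c3 c4 * (det3 c2 c4 c6 * det3 c4 c5 c7).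
  rewrite -det3_lines /b1 /b2 /b4 det3_crossp; congr (_ * _).
  exact: det3_crossp.
rewrite /y0 /y3 /y6 /z0 /z2 /z4 /z6; field.
by repeat (apply/andP; split).
Qed.

End Octagon.

End Vectors.

(** * The action of the pentagram map on the y-parameters *)

Section Represented.
(** The representatives are arbitrary because the formulas serve both for a polygon and for its
    image, where they are cross products. *)
Variables (R : realType) (A : polygon R) (a : int -> 'rV[R]_3).
Hypothesis a_neq0 : forall p, is_index A p -> a p != 0.
Hypothesis aE : forall p, is_index A p -> pt A p = <[a p]>%VS.
Hypothesis genA : generic A.
Implicit Types p q : int.

Definition br p q r : R := det3 (a p) (a q) (a r).

Lemma is_indexD p q i : is_index A p -> q = p + 2 * i -> is_index A q.
Proof. by rewrite /is_index => + ->; lia. Qed.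

Lemma chordE p i q : is_index A p -> q = p + 2 * i -> chord A p i = (<[a p]> + <[a q]>)%VS.
Proof. by move=> ip qE; rewrite /chord -qE !aE // (is_indexD ip qE). Qed.

Lemma near_indep p q : is_index A p ->
  [\/ q = p + 2, q = p + 4, q = p - 2 | q = p - 4] -> crossp (a p) (a q) != 0.
Proof.
have fwd p' i : is_index A p' -> i = 1 \/ i = 2 -> crossp (a p') (a (p' + 2 * i)) != 0.
  move=> ip hi; have iq := is_indexD ip (erefl (p' + 2 * i)).
  apply: crossp_neq0; rewrite ?a_neq0 // -!aE //.
  by have [[n1 n2] _ _ _ _] := genA ip; case: hi => ->.
move=> ip; case=> qE.
- by rewrite qE; apply: (fwd p 1) => //; left.
- by rewrite qE; apply: (fwd p 2) => //; right.
- have iq : is_index A q by apply: (@is_indexD p q (- 1)) => //; lia.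
  rewrite crosspC oppr_eq0; have -> : p = q + 2 * 1 by lia.
  by apply: fwd => //; left.
- have iq : is_index A q by apply: (@is_indexD p q (- 2)) => //; lia.
  rewrite crosspC oppr_eq0; have -> : p = q + 2 * 2 by lia.
  by apply: fwd => //; right.
Qed.

(** These are the distinctness conditions on the pencil at [p2]. The neighbours are variables with
    equations, so that the lemma applies to indices in any syntactic form. *)
Lemma br_neq0 (p0 p1 p2 p3 p4 : int) : is_index A p2 ->
  p0 = p2 - 4 -> p1 = p2 - 2 -> p3 = p2 + 2 -> p4 = p2 + 4 ->
  [/\ br p0 p1 p2 != 0, br p2 p3 p4 != 0, br p0 p2 p3 != 0 & br p1 p2 p4 != 0].
Proof.
move=> ip e0 e1 e3 e4; have [_ _ _ [n1 n2 n3 n4] _] := genA ip.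
have i0 : crossp (a p2) (a p0) != 0 by apply: near_indep => //; apply: Or44.
have i1 : crossp (a p2) (a p1) != 0 by apply: near_indep => //; apply: Or43.
have i3 : crossp (a p2) (a p3) != 0 by apply: near_indep => //; apply: Or41.
have i4 : crossp (a p2) (a p4) != 0 by apply: near_indep => //; apply: Or42.
have c0 : chord A p2 (- 2) = (<[a p2]> + <[a p0]>)%VS by apply: chordE => //; lia.
have c1 : chord A p2 (- 1) = (<[a p2]> + <[a p1]>)%VS by apply: chordE => //; lia.
have c3 : chord A p2 1 = (<[a p2]> + <[a p3]>)%VS by apply: chordE => //; lia.
have c4 : chord A p2 2 = (<[a p2]> + <[a p4]>)%VS by apply: chordE => //; lia.
rewrite c0 c1 c3 c4 in n1 n2 n3 n4; split.
- by rewrite /br -det3_cycle; apply: join_neq.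
- exact: join_neq.
- by rewrite /br det3_swap oppr_eq0; apply: join_neq.
- by rewrite /br det3_swap oppr_eq0; apply: join_neq.
Qed.

Lemma yparam_index (p0 p1 p2 p3 p4 : int) : is_index A p2 ->
  p0 = p2 - 4 -> p1 = p2 - 2 -> p3 = p2 + 2 -> p4 = p2 + 4 ->
  yparam A p2 = - ((br p0 p2 p3 * br p1 p2 p4) / (br p0 p1 p2 * br p2 p3 p4)).
Proof.
move=> ip e0 e1 e3 e4; have [n1 _ _ _] := br_neq0 ip e0 e1 e3 e4.
have c0 : chord A p2 (- 2) = (<[a p2]> + <[a p0]>)%VS by apply: chordE => //; lia.
have c1 : chord A p2 (- 1) = (<[a p2]> + <[a p1]>)%VS by apply: chordE => //; lia.
have c3 : chord A p2 1 = (<[a p2]> + <[a p3]>)%VS by apply: chordE => //; lia.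
have c4 : chord A p2 2 = (<[a p2]> + <[a p4]>)%VS by apply: chordE => //; lia.
have i0 : crossp (a p2) (a p0) != 0 by apply: near_indep => //; apply: Or44.
have i1 : crossp (a p2) (a p1) != 0 by apply: near_indep => //; apply: Or43.
have i3 : crossp (a p2) (a p3) != 0 by apply: near_indep => //; apply: Or41.
have i4 : crossp (a p2) (a p4) != 0 by apply: near_indep => //; apply: Or42.
rewrite /br -det3_cycle in n1.
rewrite /yparam ip c0 c1 c3 c4 aE // pencil_cross_ratioE // invf_div /br.
by rewrite det3_swap [det3 _ (a p1) (a p4)]det3_swap mulrNN [det3 _ (a p0) (a p1)]det3_cycle.
Qed.

Lemma yparam_nonindex (p0 p1 p2 p3 p4 p5 : int) : is_index A p2 ->
  p0 = p2 - 4 -> p1 = p2 - 2 -> p3 = p2 + 2 -> p4 = p2 + 4 -> p5 = p2 + 6 ->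
  yparam A (p2 + 1) = - ((br p0 p1 p2 * br p3 p4 p5) / (br p0 p1 p3 * br p2 p4 p5)).
Proof.
move=> ip e0 e1 e3 e4 e5; have [_ _ [n1 n2] _ _] := genA ip.
have ip0 : is_index A p0 by apply: (@is_indexD p2 p0 (- 2)) => //; lia.
have ip3 : is_index A p3 by apply: (@is_indexD p2 p3 1) => //; lia.
have ip4 : is_index A p4 by apply: (@is_indexD p2 p4 2) => //; lia.
have c0 : chord A (p2 - 4) 1 = (<[a p0]> + <[a p1]>)%VS.
  by rewrite -e0; apply: chordE => //; lia.
have c2 : chord A p2 1 = (<[a p2]> + <[a p3]>)%VS by apply: chordE => //; lia.
have c4 : chord A (p2 + 4) 1 = (<[a p4]> + <[a p5]>)%VS.
  by rewrite -e4; apply: chordE => //; lia.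
have i0 : crossp (a p0) (a p1) != 0 by apply: near_indep => //; apply: Or41; lia.
have i2 : crossp (a p2) (a p3) != 0 by apply: near_indep => //; apply: Or41; lia.
have i4 : crossp (a p4) (a p5) != 0 by apply: near_indep => //; apply: Or41; lia.
have /negbTE ni : ~~ is_index A (p2 + 1) by move: ip; rewrite /is_index; lia.
rewrite /yparam ni addrK /side_left /side_right c0 c2 c4 -e3 !aE //.
by rewrite c0 c2 in n1; rewrite c2 c4 in n2; rewrite side_cross_ratioE.
Qed.

End Represented.

Section Pentagram.
Variables (R : realType) (A : polygon R) (a : int -> 'rV[R]_3).
Hypothesis a_neq0 : forall p, is_index A p -> a p != 0.
Hypothesis aE : forall p, is_index A p -> pt A p = <[a p]>%VS.
Hypothesis genA : generic A.
Implicit Types p q : int.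

Let B := pentagram A.

Lemma is_index_pentagram q : is_index B q = ~~ is_index A q.
Proof. by rewrite /is_index /=; case: (halfint A) => /=; lia. Qed.

Lemma pt_pentagram q : is_index B q ->
  pt B q = (chord A (q - 3) 2 :&: chord A (q - 1) 2)%VS.
Proof.
rewrite /is_index /pt /= => iq.
by congr (chord A (_ - 3) 2 :&: chord A (_ - 1) 2)%VS; lia.
Qed.

Definition diag p : 'rV[R]_3 := crossp (a p) (a (p + 4)).

Definition penta_vec q : 'rV[R]_3 := crossp (diag (q - 3)) (diag (q - 1)).

Lemma penta_vecP q : is_index B q ->
  penta_vec q != 0 /\ pt B q = <[penta_vec q]>%VS.
Proof.
move=> iq; have := iq; rewrite is_index_pentagram => niq.
have i3 : is_index A (q - 3) by move: niq; rewrite /is_index; lia.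
have i1 : is_index A (q - 1) by move: niq; rewrite /is_index; lia.
have [_ n _ _ _] := genA i3.
rewrite pt_pentagram // (chordE aE i3 (q := q - 3 + 4)) //.
rewrite (chordE aE i1 (q := q - 1 + 4)) //.
apply: meet_join.
- by apply: (near_indep a_neq0) => //; apply: Or42.
- by apply: (near_indep a_neq0) => //; apply: Or42.
move: n; rewrite (_ : q - 3 + 2 = q - 1); last by lia.
by rewrite (chordE aE i3 (q := q - 3 + 4)) // (chordE aE i1 (q := q - 1 + 4)).
Qed.

Hypothesis genB : generic B.

(** If these three points were collinear, the diagonals [p0 p2] and [p2 p4] would coincide, and so
    would the adjacent vertices of [B] that they cut on the diagonal from [p2 - 2] to [p2 + 2].
    Genericity of the image is what excludes this. *)
Lemma br_wide (p0 p2 p4 : int) : is_index A p2 -> p0 = p2 - 4 -> p4 = p2 + 4 ->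
  br a p0 p2 p4 != 0.
Proof.
move=> ip e0 e4.
have ib : is_index B (p2 - 1) by rewrite is_index_pentagram; move: ip; rewrite /is_index; lia.
have ib' : is_index B (p2 + 1) by rewrite is_index_pentagram; move: ip; rewrite /is_index; lia.
have ip0 : is_index A p0 by apply: (@is_indexD _ A p2 p0 (- 2)) => //; lia.
have [[n _] _ _ _ _] := genB ib; apply: contra_neq n => d0.
rewrite (_ : p2 - 1 + 2 = p2 + 1); last by lia.
rewrite !pt_pentagram // (_ : p2 - 1 - 3 = p0); last by lia.
rewrite (_ : p2 - 1 - 1 = p2 + 1 - 3); last by lia.
rewrite (_ : p2 + 1 - 1 = p2); last by lia.
rewrite capvC; congr (_ :&: _)%VS.
have c0 : chord A p0 2 = (<[a p0]> + <[a p2]>)%VS by apply: (chordE aE) => //; lia.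
have c2 : chord A p2 2 = (<[a p2]> + <[a p4]>)%VS by apply: (chordE aE) => //; lia.
rewrite c0 c2 addvC; apply: join_eq.
- by apply: (near_indep a_neq0) => //; apply: Or44.
- by apply: (near_indep a_neq0) => //; apply: Or42.
by rewrite det3_swap -/(br a p0 p2 p4) d0 oppr0.
Qed.

Lemma yparam_index_neq0 j : is_index A j -> yparam A j != 0.
Proof.
move=> ij.
rewrite (yparam_index a_neq0 aE genA ij erefl erefl erefl erefl).
have [n1 n2 n3 n4] := br_neq0 a_neq0 aE genA ij erefl erefl erefl erefl.
by rewrite oppr_eq0 !mulf_neq0 // invr_eq0 mulf_neq0.
Qed.

Lemma add1_yparam_index (p0 p1 p2 p3 p4 : int) : is_index A p2 ->
  p0 = p2 - 4 -> p1 = p2 - 2 -> p3 = p2 + 2 -> p4 = p2 + 4 ->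
  1 + yparam A p2 = - ((br a p0 p2 p4 * br a p1 p2 p3) / (br a p0 p1 p2 * br a p2 p3 p4)).
Proof.
move=> ip e0 e1 e3 e4; have [n1 n2 _ _] := br_neq0 a_neq0 aE genA ip e0 e1 e3 e4.
rewrite (yparam_index a_neq0 aE genA ip e0 e1 e3 e4) -[in RHS]mulNr -det3_pluecker.
by rewrite mulrBl divff // mulf_neq0.
Qed.

Lemma add1_yparam_index_neq0 j : is_index A j -> 1 + yparam A j != 0.
Proof.
move=> ij.
rewrite (add1_yparam_index ij erefl erefl erefl erefl).
have [n1 n2 n3 n4] := br_neq0 a_neq0 aE genA ij erefl erefl erefl erefl.
have ij' : is_index A (j + 2) by apply: (@is_indexD _ A j _ 1).
have [||||n5 _ _ _] := br_neq0 a_neq0 aE genA ij' (p0 := j - 2) (p1 := j) (p3 := j + 4) (p4 := j + 6); try by lia.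
have wide := br_wide ij erefl erefl.
by rewrite oppr_eq0 mulf_neq0 ?invr_eq0 // mulf_neq0.
Qed.

Let b_neq0 q (iq : is_index B q) : penta_vec q != 0 := proj1 (penta_vecP iq).
Let bE q (iq : is_index B q) : pt B q = <[penta_vec q]>%VS := proj2 (penta_vecP iq).

Let br_consecutive (p0 p1 p2 : int) : is_index A p1 -> p0 = p1 - 2 -> p2 = p1 + 2 ->
  br a p0 p1 p2 != 0.
Proof.
move=> ip e0 e2; have ip2 : is_index A p2 by apply: (is_indexD ip (i := 1)); lia.
have [||||//] := br_neq0 a_neq0 aE genA ip2 (p0 := p0) (p1 := p1) (p3 := p2 + 2) (p4 := p2 + 4);
  by lia.
Qed.

Let br_left (p0 p1 p2 : int) : is_index A p1 -> p0 = p1 - 4 -> p2 = p1 + 2 ->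
  br a p0 p1 p2 != 0.
Proof.
move=> ip e0 e2.
by have [] := br_neq0 a_neq0 aE genA ip e0 erefl e2 erefl.
Qed.

Let br_right (p0 p1 p2 : int) : is_index A p1 -> p0 = p1 - 2 -> p2 = p1 + 4 ->
  br a p0 p1 p2 != 0.
Proof.
move=> ip e0 e2.
by have [] := br_neq0 a_neq0 aE genA ip erefl e0 erefl e2.
Qed.

Let penta_vecE (q p0 p1 p2 p3 : int) :
  p0 = q - 3 -> p1 = q - 1 -> p2 = q + 1 -> p3 = q + 3 ->
  penta_vec q = crossp (crossp (a p0) (a p2)) (crossp (a p1) (a p3)).
Proof.
move=> -> -> -> ->; rewrite /penta_vec /diag.
by congr (crossp (crossp _ (a _)) (crossp _ (a _))); lia.
Qed.

Ltac arith := clear; lia.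

Lemma yparam_pentagram_index j : is_index A j -> yparam B j = (yparam A j)^-1.
Proof.
move=> ij; have shift i : is_index A (j + 2 * i) by apply: is_indexD ij erefl.
have im6 : is_index A (j - 6) := shift (- 3).
have im4 : is_index A (j - 4) := shift (- 2).
have im2 : is_index A (j - 2) := shift (- 1).
have i2 : is_index A (j + 2) := shift 1.
have i4 : is_index A (j + 4) := shift 2.
have i6 : is_index A (j + 6) := shift 3.
have ib : is_index B (j - 1) by rewrite is_index_pentagram; move: ij; rewrite /is_index; lia.
(* An index of [A] is not one of [B]: there it labels the side from [j - 1] to [j + 1]. *)
rewrite -[in LHS](subrK 1 j).
rewrite (@yparam_nonindex _ B penta_vec b_neq0 bE genB
  (j - 5) (j - 3) (j - 1) (j + 1) (j + 3) (j + 5)) //; try by arith.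
rewrite (yparam_index a_neq0 aE genA ij erefl erefl erefl erefl) /br.
rewrite (@penta_vecE (j - 5) (j - 8) (j - 6) (j - 4) (j - 2)); try by arith.
rewrite (@penta_vecE (j - 3) (j - 6) (j - 4) (j - 2) j); try by arith.
rewrite (@penta_vecE (j - 1) (j - 4) (j - 2) j (j + 2)); try by arith.
rewrite (@penta_vecE (j + 1) (j - 2) j (j + 2) (j + 4)); try by arith.
rewrite (@penta_vecE (j + 3) j (j + 2) (j + 4) (j + 6)); try by arith.
rewrite (@penta_vecE (j + 5) (j + 2) (j + 4) (j + 6) (j + 8)); try by arith.
(* Here [c_i] is [a (j - 8 + 2 * i)], centred at [c4], the vertex of index [j]. *)
apply: pentagram_side.
- by apply: br_wide => //; arith.
- by apply: br_wide => //; arith.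
- by apply: br_wide => //; arith.
- by apply: br_wide => //; arith.
- by apply: br_consecutive => //; arith.
- by apply: br_consecutive => //; arith.
- by apply: br_consecutive => //; arith.
- by apply: br_consecutive => //; arith.
- by apply: br_left => //; arith.
- by apply: br_right => //; arith.
Qed.

Lemma yparam_pentagram_nonindex j : ~~ is_index A j ->
  yparam B j = yparam A (j - 3) * yparam A j * yparam A (j + 3) *
    ((1 + yparam A (j - 1)) * (1 + yparam A (j + 1)) /
     ((1 + yparam A (j - 3)) * (1 + yparam A (j + 3)))).
Proof.
move=> nij; have ib : is_index B j by rewrite is_index_pentagram.
have im1 : is_index A (j - 1) by move: nij; rewrite /is_index; lia.
have shift i : is_index A (j - 1 + 2 * i) by apply: is_indexD im1 erefl.
have im5 : is_index A (j - 5) by move: (shift (- 2)); congr (is_index A _); arith.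
have im3 : is_index A (j - 3) by move: (shift (- 1)); congr (is_index A _); arith.
have i1 : is_index A (j + 1) by move: (shift 1); congr (is_index A _); arith.
have i3 : is_index A (j + 3) by move: (shift 2); congr (is_index A _); arith.
have i5 : is_index A (j + 5) by move: (shift 3); congr (is_index A _); arith.
rewrite (@yparam_index _ B penta_vec b_neq0 bE genB (j - 4) (j - 2) j (j + 2) (j + 4)) //.
rewrite (@add1_yparam_index (j - 7) (j - 5) (j - 3) (j - 1) (j + 1)) //; try by arith.
rewrite (@add1_yparam_index (j - 5) (j - 3) (j - 1) (j + 1) (j + 3)) //; try by arith.
rewrite (@add1_yparam_index (j - 3) (j - 1) (j + 1) (j + 3) (j + 5)) //; try by arith.
rewrite (@add1_yparam_index (j - 1) (j + 1) (j + 3) (j + 5) (j + 7)) //; try by arith.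
have -> := @yparam_index _ A a a_neq0 aE genA (j - 7) (j - 5) (j - 3) (j - 1) (j + 1);
  rewrite //; try by arith.
have -> := @yparam_index _ A a a_neq0 aE genA (j - 1) (j + 1) (j + 3) (j + 5) (j + 7);
  rewrite //; try by arith.
rewrite -[yparam A j](congr1 (yparam A) (subrK 1 j)).
have -> := @yparam_nonindex _ A a a_neq0 aE genA (j - 5) (j - 3) (j - 1) (j + 1) (j + 3) (j + 5);
  rewrite //; try by arith.
rewrite /br.
rewrite (@penta_vecE (j - 4) (j - 7) (j - 5) (j - 3) (j - 1)); try by arith.
rewrite (@penta_vecE (j - 2) (j - 5) (j - 3) (j - 1) (j + 1)); try by arith.
rewrite (@penta_vecE j (j - 3) (j - 1) (j + 1) (j + 3)); try by arith.
rewrite (@penta_vecE (j + 2) (j - 1) (j + 1) (j + 3) (j + 5)); try by arith.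
rewrite (@penta_vecE (j + 4) (j + 1) (j + 3) (j + 5) (j + 7)); try by arith.
(* Here [c_i] is [a (j - 7 + 2 * i)]. *)
apply: pentagram_corner.
- by apply: br_wide => //; arith.
- by apply: br_wide => //; arith.
- by apply: br_wide => //; arith.
- by apply: br_wide => //; arith.
- by apply: br_consecutive => //; arith.
- by apply: br_consecutive => //; arith.
- by apply: br_consecutive => //; arith.
- by apply: br_consecutive => //; arith.
- by apply: br_consecutive => //; arith.
- by apply: br_consecutive => //; arith.
- by apply: br_right => //; arith.
- by apply: br_left => //; arith.
Qed.

End Pentagram.

(** * Iteration *)

Lemma zrange_uniq k : uniq (zrange k).
Proof. by rewrite /zrange map_inj_uniq ?iota_uniq // => i i'; lia. Qed.

Lemma big_zrangeS (R : comNzRingType) (g : int -> R) k :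
  \prod_(i <- zrange k.+1) g i =
  g (- k.+1%:Z) * g k.+1%:Z * \prod_(i <- zrange k) g i.
Proof.
transitivity (\prod_(i <- [:: - k.+1%:Z, k.+1%:Z & zrange k]) g i); last first.
  by rewrite 2!big_cons mulrA.
apply/perm_big/uniq_perm; first exact: zrange_uniq.
  by rewrite 2!cons_uniq zrange_uniq in_cons !mem_zrange; lia.
by move=> i; rewrite mem_zrange 2!in_cons mem_zrange; lia.
Qed.

Lemma big_zrange0 (R : comNzRingType) (g : int -> R) : \prod_(i <- zrange 0) g i = g 0.
Proof. by rewrite /zrange /= big_seq1; congr g; lia. Qed.

(** Inner indices of the wrong parity occur in two neighbouring triples and are divided out once;
    the outer triples extend the range to -(k+1) and k+1. *)
Lemma prod_alternating (R : fieldType) (g : int -> R) k :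
  (forall i : int, ~~ (2 %| i + k%:Z)%Z -> g i != 0) ->
  \prod_(i <- zrange k) (if (2 %| i + k%:Z)%Z then g (i - 1) * g i * g (i + 1)
                         else (g i)^-1) =
  \prod_(i <- zrange k.+1) g i.
Proof.
(* Induction in steps of two, since the parity pattern depends on [k]. *)
have [m] := ubnP k; elim: m k => // m IHm [|[|k]] le_km g0.
- by rewrite big_zrange0 big_zrangeS big_zrange0 /= sub0r add0r mulrAC.
- rewrite !big_zrangeS !big_zrange0 /=.
  have n0 : g 0 != 0 by apply: g0.
  have -> : - 1%:Z - 1 = - 2%:Z by lia.
  have -> : - 1%:Z + 1 = 0 by lia.
  have -> : 1%:Z - 1 = 0 by lia.
  have -> : 1%:Z + 1 = 2%:Z by lia.
  by field.
have par (i : int) : (2 %| i + k.+2%:Z)%Z = (2 %| i + k%:Z)%Z by lia.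
rewrite big_zrangeS big_zrangeS [RHS]big_zrangeS [in RHS]big_zrangeS.
under eq_bigr => i _ do rewrite par.
rewrite IHm; first last.
- by move=> i; rewrite -par; apply: g0.
- by lia.
have -> : (2 %| - k.+2%:Z + k.+2%:Z)%Z by lia.
have -> : (2 %| k.+2%:Z + k.+2%:Z)%Z by lia.
have -> : (2 %| - k.+1%:Z + k.+2%:Z)%Z = false by lia.
have -> : (2 %| k.+1%:Z + k.+2%:Z)%Z = false by lia.
have -> : - k.+2%:Z - 1 = - k.+3%:Z by lia.
have -> : - k.+2%:Z + 1 = - k.+1%:Z by lia.
have -> : k.+2%:Z - 1 = k.+1%:Z by lia.
have -> : k.+2%:Z + 1 = k.+3%:Z by lia.
have n1 : g (- k.+1%:Z) != 0 by apply: g0; lia.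
have n2 : g k.+1%:Z != 0 by apply: g0; lia.
move: n1 n2 (\prod_(i <- zrange k.+1) g i).
move: (g (- k.+1%:Z)) (g k.+1%:Z) (g (- k.+2%:Z)) (g k.+2%:Z) (g (- k.+3%:Z)) (g k.+3%:Z).
by move=> a b c d e f a0 b0 p; field; rewrite a0 b0.
Qed.

(** P_0 is empty, because the bounds on [t] contradict each other in Q_1 and Q_0. *)
Lemma Fpoly0 (R : realType) (y : int -> R) j : Fpoly y j 0 = 1.
Proof.
have none (x : Pset 0) : False.
  by have := valP x; case: (val x) => [[r s] t]; rewrite in_Pset /Qpred; lia.
rewrite /Fpoly (big_pred1 set0) => [|I]; first by rewrite big_set0.
have -> : I = set0 by apply/setP => x; case: (none x).
by rewrite /= eqxx; apply/order_idealP => x; case: (none x).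
Qed.

Section Iterated.
Variable R : realType.
Implicit Types (A : polygon R) (j : int).

Definition has_points A := forall p, is_index A p -> \dim (pt A p) = 1%N.

Definition homog A (p : int) : 'rV[R]_3 := vpick (pt A p).

Lemma homog_neq0 A : has_points A -> forall p, is_index A p -> homog A p != 0.
Proof. by move=> dA p ip; rewrite vpick0 -dimv_eq0 dA. Qed.

Lemma homogE A : has_points A -> forall p, is_index A p -> pt A p = <[homog A p]>%VS.
Proof.
move=> dA p ip; apply/esym/eqP; rewrite eqEdim -memvE memv_pick.
by rewrite dim_vline homog_neq0 // dA.
Qed.

Lemma has_points_pentagram A : has_points A -> generic A -> has_points (pentagram A).
Proof.
move=> dA gA q iq; have [v0 ->] := penta_vecP (homog_neq0 dA) (homogE dA) gA iq.
by rewrite dim_vline v0.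
Qed.

Lemma has_points_iter A k : has_points A ->
  (forall l, (l < k)%N -> generic (iter l (@pentagram R) A)) ->
  has_points (iter k (@pentagram R) A).
Proof.
move=> dA; elim: k => //= k IHk gA; apply: has_points_pentagram (gA k (leqnn _)).
by apply: IHk => l lk; apply: gA; apply: ltnW.
Qed.

Lemma is_index_iter A k j :
  is_index (iter k (@pentagram R) A) j = (2 %| j - (halfint A)%:Z - k%:Z)%Z.
Proof.
elim: k => [|k IHk] /=; first by rewrite subr0.
by rewrite is_index_pentagram IHk; lia.
Qed.

Lemma yparam_iter_pentagram k A j : has_points A ->
  (forall l, (l <= k)%N -> generic (iter l (@pentagram R) A)) ->
  is_index (iter k (@pentagram R) A) j ->
  let y := yparam A in
  yparam (iter k (@pentagram R) A) j =
  (\prod_(i <- zrange k) y (j + 3 * i)) *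
    ((Fpoly y (j - 1) k * Fpoly y (j + 1) k) /
     (Fpoly y (j - 3) k * Fpoly y (j + 3) k)).
Proof.
elim: k A => [|k IHk] A dA gA ij y.
  by rewrite !Fpoly0 big_zrange0 mulr0 addr0 mulr1 divr1 mulr1.
have gA0 : generic A := gA 0%N isT.
have gA1 : generic (pentagram A) := gA 1%N isT.
have a0 := homog_neq0 dA; have aE := homogE dA.
pose y' := yparam (pentagram A).
have := ij; rewrite is_index_iter => pj.
have ye i : is_index A i -> y' i = (y i)^-1 by apply: (yparam_pentagram_index a0 aE).
have yo i : ~~ is_index A i -> y' i = y (i - 3) * y i * y (i + 3) *
    ((1 + y (i - 1)) * (1 + y (i + 1)) / ((1 + y (i - 3)) * (1 + y (i + 3)))).
  exact: (yparam_pentagram_nonindex a0 aE).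
have y0 i : is_index A i -> y i != 0 by apply: (yparam_index_neq0 a0 aE).
have y10 i : is_index A i -> 1 + y i != 0 by apply: (add1_yparam_index_neq0 a0 aE).
pose C (j' : int) := \prod_(i <- zrange k | (2 %| i + k%:Z)%Z) (1 + y (j' + 3 * i)).
(* Shuffling needs the indices of parity j' + k to be the indices of [A]; this holds at odd distance
   from [j], as for the four polynomials of the formula. *)
have FE (j' : int) : (2 %| j' - j - 1)%Z -> Fpoly y j' k.+1 = C j' * Fpoly y' j' k.
  move=> pj'.
  have par i : (2 %| i - (j' + k%:Z))%Z = is_index A i by rewrite /is_index; lia.
  by apply: Fpoly_shuffle => i; rewrite par; [apply: y0|apply: y10|apply: ye|apply: yo].
(* The first application of the map is split off, so the induction hypothesis speaks of
   [pentagram A] and of [y']. *)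
rewrite iterSr IHk; first last.
- by rewrite -iterSr.
- by move=> l lk; rewrite -iterSr; apply: gA.
- exact: has_points_pentagram.
rewrite !FE; try by clear; lia.
(* The product of the [y'] supplies the inverse of the ratio of prefactors [C]; its monomial part
   telescopes by [prod_alternating]. *)
rewrite -/y' (_ : \prod_(i <- zrange k) y' (j + 3 * i) =
  (\prod_(i <- zrange k.+1) y (j + 3 * i)) *
  ((C (j - 1) * C (j + 1)) / (C (j - 3) * C (j + 3)))); last first.
  rewrite -prod_alternating; last first.
    by move=> i pi; apply: y0; move: pj pi; rewrite /is_index; lia.
  rewrite /C -!big_split /= -prodf_div [X in _ = _ * X]big_mkcond -big_split /=.
  apply: eq_bigr => i _; case: ifPn => pi; last first.
    by rewrite mulr1; apply: ye; move: pj pi; rewrite /is_index; lia.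
  rewrite yo; last by move: pj pi; rewrite /is_index; lia.
  have -> : j + 3 * (i - 1) = j + 3 * i - 3 by clear; lia.
  have -> : j + 3 * (i + 1) = j + 3 * i + 3 by clear; lia.
  have -> : j - 1 + 3 * i = j + 3 * i - 1 by clear; lia.
  have -> : j + 1 + 3 * i = j + 3 * i + 1 by clear; lia.
  have -> : j - 3 + 3 * i = j + 3 * i - 3 by clear; lia.
  by have -> : j + 3 + 3 * i = j + 3 * i + 3 by clear; lia.
by rewrite -mulrA mulf_div; congr (_ * (_ / _)); rewrite mulrACA.
Qed.

End Iterated.

Theorem theorem1p2 (R : realType) (n : nat) (A0 : int -> {vspace 'rV[R]_3}) :
  let A := Polygon false A0 in
  let y := yparam A in
  (0 < n)%N -> twisted n A ->
  forall k : nat, (0 < k)%N ->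
  (forall l : nat, (l <= k)%N -> generic (iter l (@pentagram R) A)) ->
  forall j : int,
    ((2 %| j + k%:Z)%Z ->
       yparam (iter k (@pentagram R) A) j =
       (\prod_(i <- zrange k) y (j + 3 * i)) *
         ((Fpoly y (j - 1) k * Fpoly y (j + 1) k) /
          (Fpoly y (j - 3) k * Fpoly y (j + 3) k))) /\
    (~~ (2 %| j + k%:Z)%Z ->
       yparam (iter k (@pentagram R) A) j =
       (\prod_(i <- zrange k.-1) y (j + 3 * i))^-1 *
         ((Fpoly y (j - 3) k.-1 * Fpoly y (j + 3) k.-1) /
          (Fpoly y (j - 1) k.-1 * Fpoly y (j + 1) k.-1))).
Proof.
move=> A y _ [dimA _] [//|k] _ gA j.
have dA : has_points A by move=> p _; apply: dimA.
split=> pj; first by apply: yparam_iter_pentagram => //; rewrite is_index_iter /=; lia.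
have gk l : (l <= k)%N -> generic (iter l (@pentagram R) A).
  by move=> lk; apply: gA; apply: ltnW.
have ij : is_index (iter k (@pentagram R) A) j by rewrite is_index_iter /=; lia.
have dk : has_points (iter k (@pentagram R) A).
  by apply: has_points_iter => // l lk; apply/gk/ltnW.
have gk1 : generic (pentagram (iter k (@pentagram R) A)) := gA k.+1 (leqnn _).
(* In the odd case [j] is an index of the previous iterate, where the last step merely inverts the
   parameter; the even formula for one step less then applies. *)
rewrite iterS (yparam_pentagram_index (homog_neq0 dk) (homogE dk) (gk k (leqnn k)) gk1 ij).
by rewrite yparam_iter_pentagram // invfM invf_div.
Qed.
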